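(* Let $\sigma_a,\sigma_A>0$, $\sigma_b\ge0$ and $\varphi=\mathrm{id}$. Then for all $x,y\in\mathbb{X}$ and $s,t\in[0,1]$ the limiting kernel satisfies $$\mathcal{K}^{x,y}_{\mathrm{id}}(s,t)=\Big(\sigma_a^2+\frac{\sigma_b^2}{\sigma_A^2}\Big)k_{sig}^{\sigma_Ax,\sigma_Ay}(s,t)-\frac{\sigma_b^2}{\sigma_A^2},$$ where $k_{sig}^{x,y}$ is the signature kernel, which for any two paths $x,y\in\mathbb{X}$ and $s,t\in[0,1]$ satisfies the linear hyperbolic PDE $$\partial_s\partial_tk_{sig}^{x,y}(s,t)=\langle\dot x_s,\dot y_t\rangle\,k_{sig}^{x,y}(s,t),\qquad k_{sig}^{x,y}(s,0)=k_{sig}^{x,y}(0,t)=1.$$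
   Context: $\mathbb{X}=\{x\in C^0([0,1];\mathbb{R}^d): x(0)=0,\ \exists\,\dot x\in L^2([0,1];\mathbb{R}^d)\}$. For positive semidefinite $\Sigma\in\mathbb{R}^{2\times2}$, $V_\varphi(\Sigma)=\mathbb{E}_{z\sim\mathcal{N}(0,\Sigma)}[\varphi(z_1)\varphi(z_2)]$. The limiting kernel $\mathcal{K}^{x,y}_\varphi:[0,1]^2\to\mathbb{R}$ (of infinite-width-depth homogeneous controlled ResNets) is the unique solution of $$\mathcal{K}^{x,y}_\varphi(s,t)=\sigma_a^2+\int_0^s\int_0^t\Big[\sigma_A^2V_\varphi\begin{pmatrix}\mathcal{K}^{x,x}_\varphi(\eta,\eta)&\mathcal{K}^{x,y}_\varphi(\eta,\tau)\\ \mathcal{K}^{x,y}_\varphi(\eta,\tau)&\mathcal{K}^{y,y}_\varphi(\tau,\tau)\end{pmatrix}+\sigma_b^2\Big]\langle\dot x_\eta,\dot y_\tau\rangle_{\mathbb{R}^d}\,d\tau\,d\eta,$$ understood jointly for the triple $(\mathcal{K}^{x,x}_\varphi,\mathcal{K}^{x,y}_\varphi,\mathcal{K}^{y,y}_\varphi)$, with positive semidefinite matrices. The signature kernel is $k_{sig}^{x,y}(s,t)=\sum_{I}Sig^I_{0,s}(x)Sig^I_{0,t}(y)$, the sum running over all words $I=(i_1,\dots,i_k)$, $k\ge0$, in the alphabet $\{1,\dots,d\}$, with $Sig^I_{0,s}(x)=\int_{0<u_1<\cdots<u_k<s}dx^{i_1}_{u_1}\cdots dx^{i_k}_{u_k}$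 (and $1$ for the empty word); its PDE is understood in integral form. *)

(* Defs.v *)
From HB Require Import structures.
From mathcomp Require Import all_boot all_order all_algebra.
From mathcomp Require Import all_classical all_reals all_analysis.
From mathcomp Require Import measurable_realfun ring lra.

Set Implicit Arguments.
Unset Strict Implicit.
Unset Printing Implicit Defensive.
Import Order.TTheory GRing.Theory Num.Theory.
Import numFieldNormedType.Exports.

Local Open Scope classical_set_scope.
Local Open Scope ring_scope.

Section paths.
Context {R : realType} {d : nat}.
Notation mu := (@lebesgue_measure R).
Implicit Types x y v : R -> 'rV[R]_d.

Definition dotv (u w : 'rV[R]_d) : R := \sum_i u ord0 i * w ord0 i.

(* Paths are total functions of which only the restriction to [0, 1] matters.
   Having a weak derivative v in L^2([0, 1]; R^d) means being a primitive of v
   on [0, 1]. *)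
Definition L2_derivative x v : Prop := forall i : 'I_d,
  [/\ measurable_fun `[0 : R, 1] (fun u => v u ord0 i),
      mu.-integrable `[0 : R, 1] (fun u => ((v u ord0 i) ^+ 2)%:E) &
      forall t, t \in `[0 : R, 1] ->
        x t ord0 i - x 0 ord0 i = \int[mu]_(u in `[0, t]) v u ord0 i].

Definition pathX x : Prop :=
  [/\ {within `[0 : R, 1], continuous x}, x 0 = 0 & exists v, L2_derivative x v].

(* A chosen representative of the class of weak derivatives, which is unique up
   to a null set; it is only used under integrals. *)
Definition velocity x : R -> 'rV[R]_d := xget (fun=> 0) (L2_derivative x).

(* Words are read from their last letter, which carries the outermost
   integration variable u_k:
   Sig^(i_1 ... i_k)_(0,s) = int_0^s Sig^(i_1 ... i_(k-1))_(0,u) dx^(i_k)_u,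
   with dx_u = velocity x u du since x is absolutely continuous. *)
Fixpoint sig_rev x (w : seq 'I_d) (s : R) : R :=
  if w is i :: w' then
    \int[mu]_(u in `[0, s]) (sig_rev x w' u * velocity x u ord0 i)
  else 1.

Definition sig x (w : seq 'I_d) (s : R) : R := sig_rev x (rev w) s.

Definition sig_term x y (s t : R) (w : seq 'I_d) : \bar R :=
  (sig x w s * sig y w t)%:E.

(* Unordered sum over all words; esum is only meaningful for nonnegative
   families, hence the positive and negative parts. It is the value of the
   series as soon as sig_term x y s t is summable. *)
Definition ksig x y (s t : R) : R :=
  fine (esum [set: seq 'I_d] (sig_term x y s t)^\+ -
        esum [set: seq 'I_d] (sig_term x y s t)^\-)%E.

(* Integral form of d_s d_t k = <x'_s, y'_t> k on [0, 1]^2 with k = 1 on the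
   two axes. *)
Definition signature_pde x y (k : R -> R -> R) : Prop :=
  [/\ (mu \x mu)%E.-integrable (`[0 : R, 1] `*` `[0 : R, 1])
        (fun p => (dotv (velocity x p.1) (velocity y p.2) * k p.1 p.2)%:E),
      forall s t, s \in `[0 : R, 1] -> t \in `[0 : R, 1] ->
        k s t = 1 + \int[mu]_(eta in `[0, s]) \int[mu]_(tau in `[0, t])
          (dotv (velocity x eta) (velocity y tau) * k eta tau),
      forall s, s \in `[0 : R, 1] -> k s 0 = 1 &
      forall t, t \in `[0 : R, 1] -> k 0 t = 1].

End paths.

Section gaussian.
Context {R : realType}.
Implicit Types S : 'M[R]_2.

Definition psd n (S : 'M[R]_n) : Prop :=
  S^T = S /\ forall u : 'rV[R]_n, 0 <= (u *m S *m u^T) ord0 ord0.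

Definition sym2 (a b c : R) : 'M[R]_2 :=
  \matrix_(i, j) if i != j then b else if i == ord0 then a else c.

(* If S 0 0 = 0 and S is positive semidefinite then S 1 0 = 0, so that the
   convention 0^-1 = 0 also covers the degenerate case. *)
Definition cholesky2 S : 'M[R]_2 :=
  let a := Num.sqrt (S 0 0) in
  let b := S 1 0 / a in
  let c := Num.sqrt (S 1 1 - b ^+ 2) in
  \matrix_(i, j) if i == ord0 then (if j == ord0 then a else 0)
                 else (if j == ord0 then b else c).

Lemma cholesky2P S : psd S -> cholesky2 S *m (cholesky2 S)^T = S.
Proof.
move=> [symS posS].
have S01 : S 0 1 = S 1 0 by rewrite -[in LHS]symS mxE.
have q (a b : R) :
    0 <= a ^+ 2 * S 0 0 + 2 * a * b * S 1 0 + b ^+ 2 * S 1 1.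
  have := posS (\row_j if j == 0 then a else b).
  rewrite !mxE !big_ord_recl big_ord0 !mxE/= !big_ord_recl !big_ord0 !mxE/=.
  rewrite (_ : lift _ _ = 1); last exact/val_inj.
  by rewrite (_ : ord0 = 0)// S01 => /le_trans; apply; lra.
have S00 : 0 <= S 0 0 by have := q 1 0; lra.
have S11 : 0 <= S 1 1 by have := q 0 1; lra.
have [b2 ab] : (S 1 0 / Num.sqrt (S 0 0)) ^+ 2 <= S 1 1 /\
    Num.sqrt (S 0 0) * (S 1 0 / Num.sqrt (S 0 0)) = S 1 0.
  have [S0|S0] := eqVneq (S 0 0) 0.
    rewrite S0 sqrtr0 invr0 mulr0 expr0n mul0r/=; split => //.
    have [//|nz] := eqVneq (S 1 0) 0; exfalso.
    have := q (- (S 1 1 + 1) / S 1 0 / 2) 1.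
    rewrite S0 (_ : _ + _ = -1); first lra.
    by field.
  have a0 : 0 < S 0 0 by rewrite lt_neqAle eq_sym S0.
  have sa0 : Num.sqrt (S 0 0) != 0 by rewrite sqrtr_eq0 -ltNge.
  split; last by rewrite mulrC divfK.
  rewrite exprMn exprVn sqr_sqrtr// ler_pdivrMr//.
  have := q (S 1 0) (- S 0 0).
  rewrite (_ : _ + _ = S 0 0 * (S 1 1 * S 0 0 - S 1 0 ^+ 2)); last by ring.
  by rewrite pmulr_rge0// subr_ge0.
have aa : Num.sqrt (S 0 0) ^+ 2 = S 0 0 by rewrite sqr_sqrtr.
have cc : Num.sqrt (S 1 1 - (S 1 0 / Num.sqrt (S 0 0)) ^+ 2) ^+ 2 =
    S 1 1 - (S 1 0 / Num.sqrt (S 0 0)) ^+ 2 by rewrite sqr_sqrtr// subr_ge0.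
apply/matrixP => i j; rewrite !mxE !big_ord_recl big_ord0 !mxE/=.
have o0 p : @Ordinal 2 0 p = 0 by exact/val_inj.
have o1 p : @Ordinal 2 1 p = 1 by exact/val_inj.
case: i j => [[|[|//]] ?] [[|[|//]] ?] /=; rewrite ?o0 ?o1.
- by rewrite mulr0 !addr0 -expr2.
- by rewrite mul0r !addr0 ab.
- by rewrite mulr0 !addr0 mulrC ab.
- by rewrite addr0 -!expr2 cc subrKC.
Qed.

Notation R2 := (measurableTypeR R * measurableTypeR R)%type.

Definition linear2 (L : 'M[R]_2) (z : R2) : R2 :=
  (L 0 0 * z.1 + L 0 1 * z.2, L 1 0 * z.1 + L 1 1 * z.2).

Lemma measurable_linear2 L : measurable_fun [set: R2] (linear2 L).
Proof.
apply/measurable_fun_pairP; split; apply: measurable_funD => /=;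
  by apply: measurable_funM.
Qed.

HB.instance Definition _ L :=
  isMeasurableFun.Build _ _ _ _ (linear2 L) (measurable_linear2 L).

(* N(0, S) as the law of L xi, where L L^T = S and xi is standard normal. *)
Definition normal2 S : probability R2 R :=
  distribution (normal_prob (0 : R) 1 \x normal_prob (0 : R) 1)%E
    (linear2 (cholesky2 S)).

Definition Vphi (phi : R -> R) S : R :=
  fine 'E_(normal2 S) [fun z => phi z.1 * phi z.2].

End gaussian.

Section limiting_kernels.
Context {R : realType} {d : nat}.
Notation mu := (@lebesgue_measure R).
Variables (sa sA sb : R) (phi : R -> R).
Implicit Types (x y : R -> 'rV[R]_d) (K : R -> R -> R).

Definition kernel_integrand x y Kxx Kxy Kyy (eta tau : R) : R :=
  (sA ^+ 2 * Vphi phi (sym2 (Kxx eta eta) (Kxy eta tau) (Kyy tau tau))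
   + sb ^+ 2) * dotv (velocity x eta) (velocity y tau).

(* Integrability on the square is what makes the double integral meaningful
   (integrals are total here); it forces Kxy to be continuous on [0, 1]^2. *)
Definition kernel_equation x y Kxx Kxy Kyy : Prop :=
  [/\ forall eta tau, eta \in `[0 : R, 1] -> tau \in `[0 : R, 1] ->
        psd (sym2 (Kxx eta eta) (Kxy eta tau) (Kyy tau tau)),
      (mu \x mu)%E.-integrable (`[0 : R, 1] `*` `[0 : R, 1])
        (fun p => (kernel_integrand x y Kxx Kxy Kyy p.1 p.2)%:E) &
      forall s t, s \in `[0 : R, 1] -> t \in `[0 : R, 1] ->
        Kxy s t = sa ^+ 2 +
          \int[mu]_(eta in `[0, s]) \int[mu]_(tau in `[0, t])
            kernel_integrand x y Kxx Kxy Kyy eta tau].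

(* K is the xy-component, on [0, 1]^2, of a solution of the joint system. *)
Definition is_limiting_kernel x y K : Prop :=
  exists Kxx Kyy,
    [/\ kernel_equation x x Kxx Kxx Kxx,
        kernel_equation x y Kxx K Kyy &
        kernel_equation y y Kyy Kyy Kyy].

End limiting_kernels.

(* Main.v *)
Require Import Defs.
From HB Require Import structures.
From mathcomp Require Import all_boot all_order all_algebra.
From mathcomp Require Import all_classical all_reals all_analysis.
From mathcomp Require Import measurable_realfun ring lra.
Import Order.TTheory GRing.Theory Num.Theory.
Import numFieldNormedType.Exports.

(** For [phi = id] the Gaussian expectation [Vphi id S] is the off-diagonal
    entry of [S], so the equation for the kernel [K] of the pair [x, y] no
    longer involves the two diagonal kernels and becomes affine in [K]:
    [K = sa^2 + int int (sA^2 K + sb^2) <x', y'>].  Hence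
    [G = K + sb^2 / sA^2] satisfies [G = c + int int <(sA x)', (sA y)'> G] with
    [c = sa^2 + sb^2 / sA^2], the integral form of the linear hyperbolic
    equation, whose solution is [c] times the signature kernel of [sA x] and
    [sA y].  It remains to solve that equation and to show uniqueness for
    velocities that are merely square integrable.

    Existence.  A signature coefficient along a word of length [n] is an
    [n]-fold iterated integral.  Applying Cauchy-Schwarz to each integration
    bounds the square of the coefficient by an iterated integral of
    constants, so that it is at most [(C s)^n / n!]
    ([cauchy_schwarz_exp_coeff], [vsigP]).  As there are [d^n] words of
    length [n], the series of the signature kernel is dominated by the
    exponential series of [d C], uniformly on the unit square
    ([word_sum_tail]).  Extending all words by one letter turns the truncation
    at length [N] into the truncation at length [N + 1] ([vpartS], by Fubini),
    and the uniform bound allows the passage to the limit in this identity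
    ([vker_rect]).

    Uniqueness.  The difference [D] of two solutions satisfies a homogeneous
    equation, so it is bounded; feeding the bound
    [D(s, t)^2 <= M (A s)^n / n!] into the equation and applying
    Cauchy-Schwarz in the first variable yields the same bound with [n + 1]
    ([goursat_unique]).

    Two further points need care.  The velocity of [sA x] is a choice of weak
    derivative, and agrees with [sA] times the velocity of [x] only almost
    everywhere; this suffices since signatures do not see null sets
    ([ae_eq_weak_derivative], [ae_eq_vsig]).  And for the kernels built above
    to solve the joint system, the covariance matrices they form have to be
    positive semidefinite: separating the empty word, the quadratic form is
    [sa^2 (a + b)^2] plus [c] times a sum of squares over the nonempty words
    ([psd_affine_ker]). *)

Set Implicit Arguments.
Unset Strict Implicit.
Unset Printing Implicit Defensive.
Local Open Scope classical_set_scope.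
Local Open Scope ring_scope.

(** * Integrals of real functions and Fubini on rectangles *)

Section real_integrals.
Context d (T : measurableType d) (R : realType).
Variable m : {measure set T -> \bar R}.
Implicit Types (A : set T) (f g : T -> R).

Lemma integrable_dominated A f g : measurable A -> measurable_fun A f ->
  (forall x, A x -> `|f x| <= g x) ->
  m.-integrable A (EFin \o g) -> m.-integrable A (EFin \o f).
Proof.
move=> mA mf fg; apply: le_integrable => //; first exact/measurable_EFinP.
by move=> x Ax /=; rewrite lee_fin (le_trans (fg _ Ax))// ler_norm.
Qed.

Lemma integrable_addr A f g : measurable A ->
  m.-integrable A (EFin \o f) -> m.-integrable A (EFin \o g) ->
  m.-integrable A (EFin \o (fun x => f x + g x)).
Proof. by move=> mA fi gi; exact: (integrableD mA fi gi). Qed.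

Lemma integrable_subr A f g : measurable A ->
  m.-integrable A (EFin \o f) -> m.-integrable A (EFin \o g) ->
  m.-integrable A (EFin \o (fun x => f x - g x)).
Proof. by move=> mA fi gi; exact: (integrableB mA fi gi). Qed.

Lemma integrable_scale A (k : R) f : measurable A ->
  m.-integrable A (EFin \o f) ->
  m.-integrable A (EFin \o (fun x => k * f x)).
Proof. by move=> mA fi; exact: (integrableZl mA k fi). Qed.

Lemma integrable_sumr (I : Type) (r : seq I) A (F : I -> T -> R) :
  measurable A -> (forall i, m.-integrable A (EFin \o F i)) ->
  m.-integrable A (EFin \o (fun x => \sum_(i <- r) F i x)).
Proof.
move=> mA iF.
rewrite (_ : EFin \o _ = fun x => \sum_(i <- r) (F i x)%:E)%E.
  by apply: integrable_sum => [|i _]; [exact: mA|exact: iF].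
by apply/funext => x /=; rewrite sumEFin.
Qed.

Lemma Rintegral_sum (I : Type) (r : seq I) A (F : I -> T -> R) :
  measurable A -> (forall i, m.-integrable A (EFin \o F i)) ->
  \int[m]_(x in A) (\sum_(i <- r) F i x) =
  \sum_(i <- r) \int[m]_(x in A) F i x.
Proof.
move=> mA iF; rewrite /Rintegral.
under eq_integral do rewrite -sumEFin.
rewrite (integral_sum mA iF) -sum_fine// => i _.
exact: integrable_fin_num.
Qed.

Lemma ge0_Rintegral_subset A (B : set T) f : measurable A -> measurable B ->
  A `<=` B -> (forall x, B x -> 0 <= f x) ->
  m.-integrable B (EFin \o f) ->
  \int[m]_(x in A) f x <= \int[m]_(x in B) f x.
Proof.
move=> mA mB AB f0 fB; apply: fine_le.
- exact/integrable_fin_num/(integrableS mB mA AB fB).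
- exact: integrable_fin_num.
- apply: ge0_subset_integral => //; exact: measurable_int fB.
Qed.

Lemma integrable_mul_sqr A f g : measurable A ->
  measurable_fun A f -> measurable_fun A g ->
  m.-integrable A (EFin \o (fun x => f x ^+ 2)) ->
  m.-integrable A (EFin \o (fun x => g x ^+ 2)) ->
  m.-integrable A (EFin \o (fun x => f x * g x)).
Proof.
move=> mA mf mg f2 g2.
apply: (@integrable_dominated _ _ (fun x => f x ^+ 2 + g x ^+ 2)) => //.
- exact: measurable_funM.
- move=> x _; rewrite normrM -(real_normK (num_real (f x))).
  rewrite -(real_normK (num_real (g x))).
  by have := sqr_ge0 (`|f x| - `|g x|); have := normr_ge0 (f x);
    have := normr_ge0 (g x); nra.
- exact: (integrableD mA f2 g2).
Qed.

(** The usual discriminant argument: [l |-> int (l f + g)^2] is a nonnegative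
    quadratic polynomial. *)
Lemma Rintegral_cauchy_schwarz A f g : measurable A ->
  measurable_fun A f -> measurable_fun A g ->
  m.-integrable A (EFin \o (fun x => f x ^+ 2)) ->
  m.-integrable A (EFin \o (fun x => g x ^+ 2)) ->
  (\int[m]_(x in A) (f x * g x)) ^+ 2 <=
  (\int[m]_(x in A) (f x ^+ 2)) * (\int[m]_(x in A) (g x ^+ 2)).
Proof.
move=> mA mf mg f2 g2.
have fg := integrable_mul_sqr mA mf mg f2 g2.
set a := \int[m]_(x in A) (f x ^+ 2).
set b := \int[m]_(x in A) (f x * g x).
set c := \int[m]_(x in A) (g x ^+ 2).
have q (l : R) : 0 <= l ^+ 2 * a + 2 * l * b + c.
  rewrite /a /b /c -!RintegralZl// -!RintegralD//=.
  - apply: Rintegral_ge0 => x _.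
    rewrite [leRHS](_ : _ = (l * f x + g x) ^+ 2) ?sqr_ge0//; ring.
  - by apply: integrable_addr => //; exact: integrable_scale.
  - exact: integrable_scale.
  - exact: integrable_scale.
have a0 : 0 <= a by apply: Rintegral_ge0 => x _; exact: sqr_ge0.
move: a0; rewrite le_eqVlt => /predU1P[a0|a0].
  rewrite -a0 mul0r; have [->|b0] := eqVneq b 0; first by rewrite expr0n.
  (* with no quadratic term, this choice of [l] makes the polynomial -1 *)
  have := q (- (c + 1) / b / 2); rewrite -a0 mulr0 add0r.
  by rewrite (_ : _ + _ = -1); [lra|field].
have := q (- b / a); rewrite (_ : _ + _ = (a * c - b ^+ 2) / a); last by field; lra.
by rewrite pmulr_lge0 ?invr_gt0// subr_ge0.
Qed.

End real_integrals.

Section product_integrals.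
Context d1 d2 (T1 : measurableType d1) (T2 : measurableType d2) (R : realType).
Variable m1 : {sigma_finite_measure set T1 -> \bar R}.
Variable m2 : {sigma_finite_measure set T2 -> \bar R}.

Lemma Rintegral_fubini (A : set T1) (B : set T2) (h : T1 * T2 -> R) :
  measurable A -> measurable B ->
  (m1 \x m2)%E.-integrable (A `*` B) (EFin \o h) ->
  \int[m1]_(x in A) \int[m2]_(y in B) h (x, y) =
  \int[(m1 \x m2)%E]_(p in A `*` B) h p.
Proof.
move=> mA mB ih.
have mAB : measurable (A `*` B) by exact: measurableX.
have ih' : (m1 \x m2)%E.-integrable setT (EFin \o (h \_ (A `*` B))).
  by rewrite -restrict_EFin; exact/(integrable_mkcond _ mAB).
rewrite [RHS]Rintegral_mkcond [in RHS]/Rintegral.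
rewrite -(integral12_prod_meas1 ih') Rintegral_mkcond /Rintegral; congr fine.
(* The inner integral may fail to be finite on a null set, where [fine] replaces it
   by 0. *)
have iF := integrable_fubini_F ih'.
rewrite [RHS](ae_eq_integral
    (EFin \o (fine \o fubini_F m2 (EFin \o (h \_ (A `*` B))))))//.
- apply: eq_integral => x _ /=; congr EFin; rewrite patchE /fubini_F.
  case: ifPn => [xA|xA].
    rewrite [in LHS]integral_mkcond; congr fine; apply: eq_integral => y _ /=.
    by rewrite !patchE /= in_setX xA /=; case: ifP.
  rewrite integral0_eq// => y _ /=.
  by rewrite patchE in_setX (negbTE xA).
- exact: measurable_int iF.
- apply/measurable_EFinP/measurableT_comp => //.
  exact: measurable_int iF.
- by have := integrable_ae measurableT iF; apply: filterS => x /= + _ => /(_ I) /fineK.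
Qed.

Lemma integrable_tensor (A : set T1) (B : set T2) f g :
  measurable A -> measurable B ->
  m1.-integrable A (EFin \o f) -> m2.-integrable B (EFin \o g) ->
  (m1 \x m2)%E.-integrable (A `*` B) (EFin \o (fun p => f p.1 * g p.2)).
Proof.
move=> mA mB fA gB.
have mAB : measurable (A `*` B) by exact: measurableX.
apply/(integrable_mkcond _ mAB); rewrite restrict_EFin.
have -> : (fun p => f p.1 * g p.2) \_ (A `*` B) =
    (fun p => (f \_ A) p.1 * (g \_ B) p.2).
  apply/funext => -[x y]; rewrite !patchE in_setX /=.
  by case: ifP; case: (x \in A); case: (y \in B); rewrite ?mul0r ?mulr0.
have {}fA : m1.-integrable setT (EFin \o (f \_ A)).
  by rewrite -restrict_EFin; exact/(integrable_mkcond _ mA).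
have {}gB : m2.-integrable setT (EFin \o (g \_ B)).
  by rewrite -restrict_EFin; exact/(integrable_mkcond _ mB).
move: (f \_ A) (g \_ B) fA gB => {f g}f g fi gi.
have mf : measurable_fun setT f by exact/measurable_EFinP/(measurable_int _ fi).
have mg : measurable_fun setT g by exact/measurable_EFinP/(measurable_int _ gi).
apply/integrable12ltyP.
  apply/measurable_EFinP/measurable_funM.
    by apply: (measurableT_comp mf).
  by apply: (measurableT_comp mg).
under eq_integral => x _.
  under eq_integral do rewrite /= normrM EFinM.
  rewrite ge0_integralZl//; last first.
    by apply/measurable_EFinP/measurableT_comp.
  over.
rewrite ge0_integralZr//; last 2 first.
  by apply/measurable_EFinP/measurableT_comp.
  exact: integral_ge0.
move/integrableP : fi => [_ fi]; move/integrableP : gi => [_ gi].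
by rewrite lte_mul_pinfty// ?integral_ge0// ge0_fin_numE ?integral_ge0.
Qed.

Lemma Rintegral_tensor (A : set T1) (B : set T2) f g :
  measurable A -> measurable B ->
  m1.-integrable A (EFin \o f) -> m2.-integrable B (EFin \o g) ->
  \int[(m1 \x m2)%E]_(p in A `*` B) (f p.1 * g p.2) =
  \int[m1]_(x in A) f x * \int[m2]_(y in B) g y.
Proof.
move=> mA mB fA gB.
rewrite -(Rintegral_fubini mA mB (integrable_tensor mA mB fA gB)) /=.
under eq_Rintegral do rewrite RintegralZl//.
by rewrite RintegralZr.
Qed.

End product_integrals.

(** * The Gaussian expectation of a product *)

Section standard_normal.
Context {R : realType}.
Notation mu := (@lebesgue_measure R).
Notation N01 := (normal_prob (0 : R) 1).
Notation pdf := (normal_pdf (0 : R) 1).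

Let g (x : R) : R := expR (- (x ^+ 2 / 2)).

Let g_ge0 x : 0 <= g x. Proof. exact: expR_ge0. Qed.

Let pdfE x : pdf x = normal_peak 1 * g x.
Proof.
rewrite normal_pdfE ?oner_eq0// /normal_fun /g subr0.
by rewrite expr1n mulNr.
Qed.

(** The second moment comes from this antiderivative of [(x^2 - 1) g].  The
    integrand changes sign at 1, so that the integrals over [[0, 1]] and
    [[1, +oo[] are evaluated separately; they cancel. *)
Let is_derive_xg (x : R) :
  is_derive x 1 (fun u => - u * g u) ((x ^+ 2 - 1) * g x).
Proof.
have hq : is_derive x 1 (- (2^-1 *: (@id R ^+ 2))) (- x).
  by apply: is_derive_eq; rewrite expr1 /GRing.scale /= mulr1; field.
have := is_deriveM (is_deriveNid x 1)
  (is_derive1_comp (is_derive_expR _) hq).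
rewrite (_ : _ * _ = fun u => - u * g u); last first.
  apply/funext => u; rewrite /g /= !fctE; congr (_ * expR _).
  by rewrite /GRing.scale /= mulrC.
move=> h; apply: is_derive_eq; rewrite /g /= !fctE /GRing.scale /=.
by rewrite (mulrC 2^-1); ring.
Qed.

Let continuous_g : continuous g.
Proof.
move=> x; apply: (@continuous_comp _ _ _ (fun u : R => - (u ^+ 2 / 2)) expR).
  apply: continuousN; apply: continuousM; last exact: cst_continuous.
  exact: exprn_continuous.
exact: continuous_expR.
Qed.

Let cvg_xg : - x * g x @[x --> +oo] --> (0 : R).
Proof.
apply/cvgrPdist_lt => e e0; near=> x.
have x0 : 0 < x by near: x; apply: nbhs_pinfty_gt; rewrite num_real.
have xe : 2 / e < x by near: x; apply: nbhs_pinfty_gt; rewrite num_real.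
rewrite sub0r mulNr opprK; rewrite ger0_norm; last exact: mulr_ge0 (ltW x0) (g_ge0 x).
rewrite /g expRN ltr_pdivrMr ?expR_gt0//.
apply: (@lt_le_trans _ _ (e * (1 + x ^+ 2 / 2))); last first.
  by rewrite ler_pM2l// expR_ge1Dx.
by move: xe; rewrite ltr_pdivrMr//; nra.
Unshelve. all: by end_near. Qed.

Let measurable_polyg (p : R -> R) : continuous p ->
  measurable_fun setT (fun x => (p x * g x)%:E).
Proof.
move=> cp; apply/measurable_EFinP; apply: continuous_measurable_fun => x.
by apply: continuousM; [exact: cp|exact: continuous_g].
Qed.

Let continuous_sqr : continuous (fun x : R => x ^+ 2).
Proof. exact: exprn_continuous. Qed.

Let continuous_sqrB1 : continuous (fun x : R => x ^+ 2 - 1).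
Proof.
by move=> x; apply: cvgB; [exact: continuous_sqr|exact: cvg_cst].
Qed.

Let continuous_1Bsqr : continuous (fun x : R => 1 - x ^+ 2).
Proof.
by move=> x; apply: cvgB; [exact: cvg_cst|exact: continuous_sqr].
Qed.

Let continuous_polyg (p : R -> R) : continuous p ->
  continuous (fun x => p x * g x).
Proof.
by move=> cp x; apply: continuousM; [exact: cp|exact: continuous_g].
Qed.

Let integral_tail :
  (\int[mu]_(x in `[1%R, +oo[) ((x ^+ 2 - 1) * g x)%:E = (g 1)%:E)%E.
Proof.
rewrite (@ge0_continuous_FTC2y _ _ (fun u => - u * g u) _ 0).
- by rewrite -EFinB; congr EFin; ring.
- by move=> x x1; rewrite mulr_ge0// subr_ge0 expr_ge1// (le_trans ler01).
- apply: continuous_subspaceT; exact: continuous_polyg continuous_sqrB1.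
- exact: cvg_xg.
- by move=> x _; have [] := is_derive_xg x.
- apply: cvg_at_right_filter.
  have := @differentiable_continuous _ _ _ (1 : R) (fun u => - u * g u).
  apply; apply/derivable1_diffP; by have [] := is_derive_xg 1.
- by move=> x _; rewrite derive1E; have [] := is_derive_xg x.
Qed.

Let integral_head :
  (\int[mu]_(x in `[0%R, 1%R]) ((1 - x ^+ 2) * g x)%:E = (g 1)%:E)%E.
Proof.
have cF (z : R) : {for z, continuous (fun u : R => - (- u * g u))}.
  apply: continuousN; apply: differentiable_continuous.
  by apply/derivable1_diffP; have [] := is_derive_xg z.
rewrite (@continuous_FTC2 _ _ (fun u : R => - (- u * g u)))//.
- by rewrite -EFinB; congr EFin; ring.
- apply: continuous_subspaceT; exact: continuous_polyg continuous_1Bsqr.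
- split.
  + by move=> x _; apply: derivableN; have [] := is_derive_xg x.
  + by apply: cvg_at_right_filter; exact: cF.
  + by apply: cvg_at_left_filter; exact: cF.
- move=> x _; rewrite derive1E deriveN; last by have [] := is_derive_xg x.
  by have [_ ->] := is_derive_xg x; ring.
Qed.

Let integral_half :
  (\int[mu]_(x in `[0%R, +oo[) (x ^+ 2 * g x)%:E =
   \int[mu]_(x in `[0%R, +oo[) (g x)%:E)%E.
Proof.
have mg (A : set R) : measurable_fun A (fun x => (g x)%:E).
  apply: measurable_funTS; apply/measurable_EFinP; exact: continuous_measurable_fun.
have mp (p : R -> R) (A : set R) : continuous p ->
    measurable_fun A (fun x => (p x * g x)%:E).
  by move=> cp; apply: measurable_funTS; exact: measurable_polyg.
have split (f : R -> R) : measurable_fun setT (fun x => (f x)%:E) ->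
    (forall x, 0 <= f x) ->
    (\int[mu]_(x in `[0%R, +oo[) (f x)%:E =
     \int[mu]_(x in `[0%R, 1%R]) (f x)%:E +
     \int[mu]_(x in `[1%R, +oo[) (f x)%:E)%E.
  move=> mf f0; rewrite -[X in (_ = _ + X)%E]integral_itv_obnd_cbnd; last first.
    exact: measurable_funTS mf.
  rewrite -ge0_integral_setU//.
  - by rewrite -(@itv_bndbnd_setU _ _ _ (BRight (1 : R)))// bnd_simp.
  - exact: measurable_funTS mf.
  - by move=> x _; rewrite lee_fin.
  - rewrite disj_set2E; apply/eqP; rewrite -subset0 => x [] /=.
    by rewrite !in_itv/= => /andP[_ x1]; rewrite ltNge x1.
rewrite (split (fun x => x ^+ 2 * g x)); last 2 first.
  exact: mp.
  by move=> x; rewrite mulr_ge0// sqr_ge0.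
rewrite (split g)//.
rewrite [X in (_ + X = _)%E](_ : _ =
    (g 1)%:E + \int[mu]_(x in `[1%R, +oo[) (g x)%:E)%E; last first.
  rewrite -integral_tail -ge0_integralD//.
  - by apply: eq_integral => x _; rewrite -EFinD; congr EFin; ring.
  - move=> x /=; rewrite in_itv/= andbT => x1.
    by rewrite lee_fin mulr_ge0// subr_ge0 expr_ge1// (le_trans ler01).
  - exact: mp.
  - by move=> x _; rewrite lee_fin.
  - exact: mg.
rewrite [X in (_ = X + _)%E](_ : _ =
    (g 1)%:E + \int[mu]_(x in `[0%R, 1%R]) (x ^+ 2 * g x)%:E)%E; last first.
  rewrite -integral_head -ge0_integralD//.
  - by apply: eq_integral => x _; rewrite -EFinD; congr EFin; ring.
  - move=> x /=; rewrite in_itv/= => /andP[x0 x1].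
    by rewrite lee_fin mulr_ge0// subr_ge0 exprn_ile1.
  - exact: mp.
  - by move=> x _; rewrite lee_fin mulr_ge0// sqr_ge0.
  - exact: mp.
by rewrite addeCA addeA.
Qed.

Let setcy : [set x : R | 0 <= x] = `[0, +oo[%classic.
Proof. by apply/seteqP; split => x /=; rewrite in_itv/= andbT. Qed.

Lemma integral_sqr_normal_pdf :
  (\int[mu]_x (x ^+ 2 * pdf x)%:E = 1)%E.
Proof.
rewrite -(integral_normal_pdf (0 : R) 1).
under eq_integral => x _ do rewrite pdfE mulrCA.
under [in RHS]eq_integral => x _ do rewrite pdfE.
have c (f : R -> R) : continuous f ->
    continuous (fun x : R => normal_peak 1 * f x).
  by move=> cf x; apply: cvgM; [exact: cvg_cst|exact: cf].
have mg (A : set R) : measurable_fun A (fun x => (g x)%:E).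
  apply: measurable_funTS; apply/measurable_EFinP; exact: continuous_measurable_fun.
rewrite !ge0_symfun_integralT//=.
- congr (_ * _)%E; rewrite setcy.
  under eq_integral do rewrite EFinM.
  under [in RHS]eq_integral do rewrite EFinM.
  rewrite !ge0_integralZl//=.
  + by rewrite integral_half.
  + exact: mg.
  + by move=> x _; rewrite lee_fin.
  + by rewrite lee_fin normal_peak_ge0.
  + by apply: measurable_funTS; exact: measurable_polyg.
  + by move=> x _; rewrite lee_fin mulr_ge0// sqr_ge0.
  + by rewrite lee_fin normal_peak_ge0.
- by move=> x; rewrite mulr_ge0 ?normal_peak_ge0.
- exact: c.
- by move=> x /=; rewrite /g sqrrN.
- by move=> x; rewrite mulr_ge0 ?normal_peak_ge0// mulr_ge0// sqr_ge0.
- exact/c/continuous_polyg.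
- by move=> x /=; rewrite /g sqrrN.
Qed.

(** The density is a Radon-Nikodym derivative, by uniqueness of the latter up
    to null sets. *)
Lemma ge0_integral_normal_prob (f : R -> R) :
  measurable_fun setT f -> (forall x, 0 <= f x) ->
  (\int[N01]_x (f x)%:E = \int[mu]_x (f x * pdf x)%:E)%E.
Proof.
move=> mf f0.
have dom := normal_prob_dominates (0 : R) 1.
rewrite -(Radon_Nikodym_SigmaFinite.change_of_variables dom)//;
  last exact/measurable_EFinP.
under [RHS]eq_integral do rewrite EFinM.
have iRN := Radon_Nikodym_SigmaFinite.f_integrable dom.
have mp : measurable_fun setT (EFin \o pdf).
  by apply/measurable_EFinP; exact: measurable_normal_pdf.
apply: ae_eq_integral => //.
- apply: emeasurable_funM; [exact/measurable_EFinP|exact: measurable_int iRN].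
- by apply: emeasurable_funM; [exact/measurable_EFinP|exact: mp].
- apply: ae_eqe_mul2l; apply: integral_ae_eq => // E _ mE.
  by rewrite -Radon_Nikodym_SigmaFinite.f_integral.
Qed.

Lemma integral_sqr_normal : (\int[N01]_x (x ^+ 2)%:E = 1)%E.
Proof.
rewrite ge0_integral_normal_prob ?integral_sqr_normal_pdf//.
by move=> x; exact: sqr_ge0.
Qed.

Lemma integrable_sqr_normal :
  N01.-integrable setT (EFin \o (fun x : R => x ^+ 2)).
Proof.
apply/integrableP; split.
  apply/measurable_EFinP; exact: continuous_measurable_fun.
under eq_integral do rewrite /= ger0_norm ?sqr_ge0//.
by rewrite integral_sqr_normal ltry.
Qed.

Lemma integrable_id_normal : N01.-integrable setT (EFin \o (@id R)).
Proof.
have i1 : N01.-integrable setT (EFin \o (cst 1 : R -> R)).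
  exact: finite_measure_integrable_cst.
have := @integrable_mul_sqr _ _ _ N01 setT (cst 1 : R -> R) id measurableT.
rewrite (_ : (fun x => cst 1 x * id x) = id).
  apply => //; last exact: integrable_sqr_normal.
  by rewrite (_ : (fun _ => _) = cst 1 :> (_ -> _))//; apply/funext => x /=;
    rewrite expr1n.
by apply/funext => x /=; rewrite mul1r.
Qed.

(** The positive and negative parts of the identity are exchanged by the
    reflection, which preserves the law. *)
Lemma Rintegral_id_normal : \int[N01]_x x = 0.
Proof.
rewrite /Rintegral.
suff -> : (\int[N01]_x x%:E = 0)%E by [].
rewrite integralE.
suff -> : (\int[N01]_x (fun x => x%:E)^\+ x =
           \int[N01]_x (fun x => x%:E)^\- x)%E.
  rewrite subee//.
  exact/integrable_fin_num/integrable_funeneg/integrable_id_normal.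
have -> : (fun x : R => x%:E)^\+%E = EFin \o (fun x => Num.max x 0).
  by apply/funext => x; rewrite funeposE /= EFin_max.
have -> : (fun x : R => x%:E)^\-%E = EFin \o (fun x => Num.max (- x) 0).
  by apply/funext => x; rewrite funenegE /= EFin_max.
rewrite !ge0_integral_normal_prob//; last 4 first.
- exact: measurable_funrneg.
- by move=> x; rewrite le_max lexx orbT.
- exact: measurable_funrpos.
- by move=> x; rewrite le_max lexx orbT.
pose f (x : R) := (Num.max x 0 * pdf x)%:E.
have mf : measurable_fun setT f.
  apply/measurable_EFinP/measurable_funM; last exact: measurable_normal_pdf.
  exact: measurable_funrpos.
have f0 x : (0 <= f x)%E.
  by rewrite lee_fin mulr_ge0 ?normal_pdf_ge0// le_max lexx orbT.
rewrite [RHS](_ : _ = \int[mu]_x (f (- x)%R))%E; last first.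
  by apply: eq_integral => x _; rewrite /f !pdfE /g sqrrN.
rewrite -[RHS]/(\int[mu]_(x in (-%R : _ -> measurableTypeR R) @^-1` setT)
  (f \o -%R) x)%E.
rewrite -ge0_integral_pushforward//=.
by apply: eq_measure_integral => //= A mA _; exact/esym/lebesgue_measureN.
Qed.

End standard_normal.

Section gaussian_identity.
Context {R : realType}.
Notation N01 := (normal_prob (0 : R) 1).

(** Only the factorization [S = L L^T] and the moments of the standard normal
    law matter: as [L] is lower triangular, the product of the two coordinates
    of [L xi] is [b xi_1^2 + k xi_1 xi_2]. *)
Lemma Vphi_id (a b c : R) : psd (sym2 a b c) -> Vphi id (sym2 a b c) = b.
Proof.
set S := sym2 a b c => pS.
have := congr1 (fun M : 'M[R]_2 => M 0 1) (cholesky2P pS).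
rewrite !mxE/= !big_ord_recl big_ord0 !mxE/= mul0r !addr0.
set L00 := Num.sqrt _; set L10 := _ / _ => L01.
pose k : R := L00 * cholesky2 S 1 1.
pose P := (N01 \x N01)%E.
have i1 : N01.-integrable setT (EFin \o (cst 1 : R -> R)).
  exact: finite_measure_integrable_cst.
have i11 : P.-integrable setT (EFin \o (fun p => p.1 ^+ 2 * cst 1 p.2)).
  rewrite -setXTT.
  by apply: (@integrable_tensor _ _ _ _ _ N01 N01 setT setT
    (fun x => x ^+ 2) (cst 1)) => //; exact: integrable_sqr_normal.
have i12 : P.-integrable setT (EFin \o (fun p => p.1 * p.2)).
  rewrite -setXTT.
  by apply: (@integrable_tensor _ _ _ _ _ N01 N01 setT setT id id) => //;
    exact: integrable_id_normal.
have zE : (fun p : R * R => p.1 * p.2) \o linear2 (cholesky2 S) =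
    fun p => b * (p.1 ^+ 2 * cst 1 p.2) + k * (p.1 * p.2).
  apply/funext => p /=.
  have -> : cholesky2 S 0 1 = 0 by rewrite mxE.
  have -> : cholesky2 S 0 0 = L00 by rewrite !mxE.
  have -> : cholesky2 S 1 0 = L10 by rewrite !mxE.
  by rewrite -L01 /k; ring.
have iz : P.-integrable setT
    (EFin \o ((fun p : R * R => p.1 * p.2) \o linear2 (cholesky2 S))).
  by rewrite zE; apply: integrable_addr => //; exact: integrable_scale.
rewrite /Vphi /normal2 unlock.
rewrite integral_distribution; last 2 first.
- apply/measurable_EFinP/measurable_funM => //.
- exact: iz.
rewrite -[LHS]/(\int[P]_p
  ((fun p : R * R => p.1 * p.2) \o linear2 (cholesky2 S)) p) zE.
rewrite RintegralD//; [|exact: integrable_scale..].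
rewrite !RintegralZl// -setXTT.
have /= -> := @Rintegral_tensor _ _ _ _ _ N01 N01 setT setT id id
  measurableT measurableT integrable_id_normal integrable_id_normal.
have /= -> := @Rintegral_tensor _ _ _ _ _ N01 N01 setT setT
  (fun x => x ^+ 2) (cst 1)
  measurableT measurableT integrable_sqr_normal i1.
rewrite Rintegral_id_normal mulr0 mulr0 addr0.
have -> : \int[N01]_x (x ^+ 2) = 1 by rewrite /Rintegral integral_sqr_normal.
by rewrite Rintegral_cst//; have /= -> := probability_setT N01; rewrite !mulr1.
Qed.

End gaussian_identity.

(** * Square-integrable functions on the unit interval *)

Section unit_interval.
Context {R : realType}.
Notation mu := (@lebesgue_measure R).

Definition sqint (f : R -> R) : Prop :=
  measurable_fun `[0 : R, 1] f /\
  mu.-integrable `[0 : R, 1] (EFin \o (fun u => f u ^+ 2)).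

Lemma subset_itv0 (s : R) : s \in `[0 : R, 1] ->
  `[0, s]%classic `<=` `[0, 1]%classic.
Proof.
rewrite in_itv/= => /andP[_ s1] u /=.
by rewrite !in_itv/= => /andP[-> /le_trans->].
Qed.

Lemma integrable_itv0 (s : R) (f : R -> R) : s \in `[0 : R, 1] ->
  mu.-integrable `[0 : R, 1] (EFin \o f) ->
  mu.-integrable `[0, s] (EFin \o f).
Proof.
by move=> s01; apply: integrableS => //; exact: subset_itv0.
Qed.

Lemma integrable_cst01 (k : R) : mu.-integrable `[0 : R, 1] (EFin \o cst k).
Proof.
apply/integrableP; split; first exact/measurable_EFinP/measurable_cst.
rewrite (eq_integral (cst `|k|%:E)) ?integral_cst//=.
by rewrite lebesgue_measure_itv/= lte01 oppr0 adde0 mule1 ltry.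
Qed.

Lemma sqint_integrable f : sqint f -> mu.-integrable `[0 : R, 1] (EFin \o f).
Proof.
move=> [mf f2].
have := @integrable_mul_sqr _ _ _ mu `[0 : R, 1] f (cst 1) _ mf _ f2.
rewrite (_ : (fun x => f x * _) = f); last first.
  by apply/funext => x /=; rewrite mulr1.
apply => //; rewrite (_ : (fun _ => _) = cst 1).
  exact: integrable_cst01.
by apply/funext => x /=; rewrite expr1n.
Qed.

Lemma integrable_bounded01 (f a : R -> R) (B : R) :
  measurable_fun `[0 : R, 1] f -> (forall u, u \in `[0 : R, 1] -> `|f u| <= B) ->
  mu.-integrable `[0 : R, 1] (EFin \o a) ->
  mu.-integrable `[0 : R, 1] (EFin \o (fun u => f u * a u)).
Proof.
move=> mf fB ia.
apply: (@integrable_dominated _ _ _ mu _ _ (fun u => B * `|a u|)) => //.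
- by have /measurable_EFinP ma := measurable_int _ ia; exact: measurable_funM.
- by move=> u Iu; rewrite normrM ler_wpM2r// fB.
- apply: integrable_scale => //; exact: integrable_norm.
Qed.

Lemma continuous_primitive01 (f : R -> R) :
  mu.-integrable `[0 : R, 1] (EFin \o f) ->
  {within `[0 : R, 1], continuous (fun s => \int[mu]_(u in `[0, s]) f u)}.
Proof. by move=> fi; exact: parameterized_integral_continuous. Qed.

Lemma measurable_primitive01 (f : R -> R) :
  mu.-integrable `[0 : R, 1] (EFin \o f) ->
  measurable_fun `[0 : R, 1] (fun s => \int[mu]_(u in `[0, s]) f u).
Proof.
move=> fi; apply: subspace_continuous_measurable_fun => //.
exact: continuous_primitive01.
Qed.

Lemma continuous_exp_coeff (C : R) n : continuous (fun u => exp_coeff (C * u) n).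
Proof.
move=> u; apply: cvgM; last exact: cvg_cst.
apply: (@continuous_comp _ _ _ (fun u : R => C * u) (fun z => z ^+ n)).
  by apply: cvgM; [exact: cvg_cst|exact: cvg_id].
exact: exprn_continuous.
Qed.

Lemma Rintegral_exp_coeff (C s : R) n : 0 <= s ->
  \int[mu]_(u in `[0, s]) (C * exp_coeff (C * u) n) = exp_coeff (C * s) n.+1.
Proof.
rewrite le_eqVlt => /predU1P[<-|s0].
  by rewrite set_itv1 Rintegral_set1 /exp_coeff /= mulr0 expr0n/= mul0r.
pose F (u : R) := exp_coeff (C * u) n.+1.
have dF (u : R) : is_derive u 1 F (C * exp_coeff (C * u) n).
  have h : is_derive u 1 ((n.+1`!%:R^-1 : R) *: ((C *: (@id R)) ^+ n.+1))
     (C * exp_coeff (C * u) n).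
    apply: is_derive_eq; rewrite /GRing.scale /= mulr1 /exp_coeff /=.
    rewrite factS natrM.
    have n1 : n.+1%:R != 0 :> R by rewrite pnatr_eq0.
    have n2 : n`!%:R != 0 :> R by rewrite pnatr_eq0 -lt0n fact_gt0.
    rewrite -[C *: u]/(C * u).
    by move: (n.+1%:R : R) (n`!%:R : R) n1 n2 => p q p0 q0; field; rewrite p0 q0.
  move: h; rewrite [X in is_derive _ _ X _](_ : _ = F)//.
  by apply/funext => v; rewrite !fctE /F /exp_coeff /= /GRing.scale /= mulrC.
have cF : continuous F by exact: continuous_exp_coeff.
rewrite /Rintegral (@continuous_FTC2 _ _ F)//.
- have F0 : F 0 = 0 by rewrite /F /exp_coeff /= mulr0 expr0n/= mul0r.
  by rewrite -EFinB F0 subr0.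
- apply: continuous_subspaceT => u.
  by apply: cvgM; [exact: cvg_cst|exact: continuous_exp_coeff].
- split; first by move=> u _; have [] := dF u.
    by apply: cvg_at_right_filter; exact: cF.
  by apply: cvg_at_left_filter; exact: cF.
- by move=> u _; rewrite derive1E; have [] := dF u.
Qed.

(** The induction step behind all estimates: integrating against a function
    whose square has integral at most [C] improves a bound of the order
    [(C u)^n / n!] on the square to the next term of the exponential series. *)
Lemma cauchy_schwarz_exp_coeff (f a : R -> R) (M C s : R) n :
  0 <= M -> measurable_fun `[0 : R, 1] f -> sqint a ->
  \int[mu]_(u in `[0, 1]) (a u ^+ 2) <= C ->
  (forall u, u \in `[0 : R, 1] -> f u ^+ 2 <= M * exp_coeff (C * u) n) ->
  s \in `[0 : R, 1] ->
  (\int[mu]_(u in `[0, s]) (f u * a u)) ^+ 2 <= M * exp_coeff (C * s) n.+1.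
Proof.
move=> M0 mf [ma ia] aC fM s01.
have s0 : 0 <= s by move: s01; rewrite in_itv/= => /andP[].
have sub := subset_itv0 s01.
have C0 : 0 <= C.
  by apply: le_trans aC; apply: Rintegral_ge0 => u _; exact: sqr_ge0.
have mf' : measurable_fun `[0, s] f by exact: measurable_funS mf.
have ma' : measurable_fun `[0, s] a by exact: measurable_funS ma.
have ia' : mu.-integrable `[0, s] (EFin \o (fun u => a u ^+ 2)).
  exact: integrableS ia.
have ie : mu.-integrable `[0, s] (EFin \o (fun u => M * exp_coeff (C * u) n)).
  apply: integrable_scale => //.
  apply: continuous_compact_integrable; first exact: segment_compact.
  exact/continuous_subspaceT/continuous_exp_coeff.
have fM' u : u \in `[0, s]%classic -> f u ^+ 2 <= M * exp_coeff (C * u) n.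
  by rewrite inE => /sub; exact: fM.
have if2 : mu.-integrable `[0, s] (EFin \o (fun u => f u ^+ 2)).
  apply: integrable_dominated ie => //; first exact: measurable_funX.
  by move=> u us; rewrite ger0_norm ?sqr_ge0// fM'// inE.
have m0s : measurable (`[0, s]%classic : set (measurableTypeR R)) by [].
apply: le_trans (Rintegral_cauchy_schwarz m0s mf' ma' if2 ia') _.
rewrite -Rintegral_exp_coeff// -[leRHS]mulr1.
apply: (@le_trans _ _ (\int[mu]_(u in `[0, s]) (M * exp_coeff (C * u) n) * C)).
  apply: ler_pM.
  - by apply: Rintegral_ge0 => u _; exact: sqr_ge0.
  - by apply: Rintegral_ge0 => u _; exact: sqr_ge0.
  - by apply: le_Rintegral => // u us; apply: fM'; rewrite inE.
  - apply: le_trans aC; apply: ge0_Rintegral_subset => // u _.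
    exact: sqr_ge0.
rewrite mulr1.
have ie' : mu.-integrable `[0, s] (EFin \o (fun u => exp_coeff (C * u) n)).
  apply: continuous_compact_integrable; first exact: segment_compact.
  exact/continuous_subspaceT/continuous_exp_coeff.
by rewrite !RintegralZl// -mulrA (mulrC C).
Qed.

End unit_interval.

(** * Signatures driven by a velocity, and weak derivatives *)

Section velocity_signature.
Context {R : realType} {d : nat}.
Notation mu := (@lebesgue_measure R).
Implicit Types (v : R -> 'rV[R]_d) (w : seq 'I_d).

Definition sqint_vec v : Prop := forall i : 'I_d, sqint (fun u => v u ord0 i).

(** [sig_rev] of a path, with the chosen velocity replaced by an arbitrary
    driving field, so as to compare different weak derivatives and to apply
    the theory to [sA *: velocity x]. *)
Fixpoint vsig v w (s : R) : R :=
  if w is i :: w' then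
    \int[mu]_(u in `[0, s]) (vsig v w' u * v u ord0 i)
  else 1.

Definition energy v : R :=
  \sum_i \int[mu]_(u in `[0 : R, 1]) (v u ord0 i ^+ 2).

Lemma energy_ge0 v : 0 <= energy v.
Proof.
by apply: sumr_ge0 => i _; apply: Rintegral_ge0 => u _; exact: sqr_ge0.
Qed.

Lemma le_energy v i :
  \int[mu]_(u in `[0 : R, 1]) (v u ord0 i ^+ 2) <= energy v.
Proof.
rewrite /energy (bigD1 i)//= lerDl.
by apply: sumr_ge0 => j _; apply: Rintegral_ge0 => u _; exact: sqr_ge0.
Qed.

Lemma exp_coeff_le (a b : R) n : 0 <= a -> a <= b ->
  exp_coeff a n <= exp_coeff b n.
Proof.
move=> a0 ab; rewrite /exp_coeff /= ler_wpM2r ?invr_ge0//.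
by apply: lerXn2r => //; rewrite nnegrE// (le_trans a0).
Qed.

Lemma vsigP v (C : R) : sqint_vec v -> energy v <= C -> forall w,
  measurable_fun `[0 : R, 1] (vsig v w) /\
  forall s, s \in `[0 : R, 1] -> vsig v w s ^+ 2 <= exp_coeff (C * s) (size w).
Proof.
move=> sv vC; elim=> [|i w [mw bw]] /=.
  split; first exact: measurable_cst.
  by move=> s _; rewrite /exp_coeff /= expr0 expr1n fact0 divr1.
have C0 : 0 <= C := le_trans (energy_ge0 v) vC.
split; last first.
  move=> s s01; rewrite -[leRHS]mul1r.
  apply: cauchy_schwarz_exp_coeff => //.
  - exact: le_trans (le_energy v i) vC.
  - by move=> u u01; rewrite mul1r; exact: bw.
apply: measurable_primitive01.
apply: (@integrable_bounded01 _ _ _ (1 + exp_coeff C (size w))) => //.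
  move=> u u01; have := bw u u01; rewrite -(real_normK (num_real (vsig v w u))).
  have h : exp_coeff (C * u) (size w) <= exp_coeff C (size w).
    move: u01; rewrite in_itv/= => /andP[u0 u1].
    by apply: exp_coeff_le; rewrite ?mulr_ge0// ler_piMr.
  by have := normr_ge0 (vsig v w u); nra.
exact/sqint_integrable/(sv i).
Qed.

Lemma measurable_vsig v w : sqint_vec v -> measurable_fun `[0 : R, 1] (vsig v w).
Proof. by move=> /vsigP /(_ (lexx _)) /(_ w) []. Qed.

Lemma vsig_bound v w : sqint_vec v -> forall s, s \in `[0 : R, 1] ->
  vsig v w s ^+ 2 <= exp_coeff (energy v) (size w).
Proof.
move=> /vsigP /(_ (lexx _)) /(_ w) [_ b] s s01.
apply: le_trans (b s s01) _.
move: s01; rewrite in_itv/= => /andP[u0 u1].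
by apply: exp_coeff_le; rewrite ?mulr_ge0 ?energy_ge0// ler_piMr ?energy_ge0.
Qed.

Lemma vsig_bounded v w : sqint_vec v ->
  exists B, forall s, s \in `[0 : R, 1] -> `|vsig v w s| <= B.
Proof.
move=> sv; exists (1 + exp_coeff (energy v) (size w)) => s s01.
have := vsig_bound w sv s01.
rewrite -(real_normK (num_real (vsig v w s))).
by have := normr_ge0 (vsig v w s); nra.
Qed.

Lemma integrable_vsig v w i : sqint_vec v ->
  mu.-integrable `[0 : R, 1] (EFin \o (fun u => vsig v w u * v u ord0 i)).
Proof.
move=> sv; have [B wB] := vsig_bounded w sv.
apply: (integrable_bounded01 (measurable_vsig w sv) wB).
exact/sqint_integrable/(sv i).
Qed.

Lemma ae_eq_vsig v v' : sqint_vec v -> sqint_vec v' ->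
  (forall i, {ae mu, forall u, `[0 : R, 1]%classic u ->
     v u ord0 i = v' u ord0 i}) ->
  forall w s, s \in `[0 : R, 1] -> vsig v w s = vsig v' w s.
Proof.
move=> sv sv' vv'; elim=> [//|i w ih] s s01 /=.
have sub := subset_itv0 s01.
have iv := integrable_itv0 s01 (integrable_vsig w i sv).
have iv' := integrable_itv0 s01 (integrable_vsig w i sv').
rewrite /Rintegral; congr fine; apply: ae_eq_integral => //.
- exact: measurable_int iv.
- exact: measurable_int iv'.
- move: (vv' i); apply: filterS.
    exact: (ae_filter_ringOfSetsType mu).
  move=> u /= h us.
  by rewrite h; [rewrite ih//; exact: sub|exact: sub].
Qed.

End velocity_signature.

Section weak_derivative.
Context {R : realType}.
Notation mu := (@lebesgue_measure R).

(** By Lebesgue differentiation, a locally integrable function is almost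
    everywhere the derivative of its primitive, which is constant here. *)
Lemma ae_eq0_primitive (f : R -> R) :
  mu.-integrable `[0 : R, 1] (EFin \o f) ->
  (forall t, t \in `[0 : R, 1] -> \int[mu]_(u in `[0, t]) f u = 0) ->
  {ae mu, forall u, `[0 : R, 1]%classic u -> f u = 0}.
Proof.
move=> fi f0.
have m01 : measurable (`[0, 1]%classic : set (measurableTypeR R)) by [].
have fi' : mu.-integrable setT (EFin \o (f \_ `[0 : R, 1])).
  by rewrite -restrict_EFin; exact/(integrable_mkcond _ m01).
(* Integrating from -1 makes 0 an interior point. *)
have F0 y : \int[mu]_(u in `[-1, y]) (f \_ `[0 : R, 1]) u = 0.
  rewrite -Rintegral_mkcondr.
  have [y0|y0] := ltP y 0.
    rewrite (_ : _ `&` _ = set0) ?Rintegral_set0//.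
    rewrite -subset0 => u [] /=; rewrite !in_itv/= => /andP[_ uy] /andP[u0 _].
    by have := le_lt_trans (le_trans u0 uy) y0; rewrite ltxx.
  rewrite (_ : _ `&` _ = `[0, Num.min y 1]%classic).
    by apply: f0; rewrite in_itv/= le_min y0 ler01 ge_min lexx orbT.
  apply/seteqP; split => u /=; rewrite !in_itv/= le_min.
    by case=> /andP[_ ->] /andP[-> ->].
  by move=> /andP[u0 /andP[-> ->]]; rewrite u0 (le_trans _ u0) ?lerN10.
have iy y : mu.-integrable `[-1, y] (EFin \o (f \_ `[0 : R, 1])).
  apply: (integrableS measurableT _ (@subsetT _ _) fi').
  exact: measurable_itv.
have := FTC1 iy (integrable_locally m01 fi).
apply: filterS.
  exact: (ae_filter_ringOfSetsType mu).
move=> u /= h u01.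
have u0 : (((-1)%:E : \bar R) < u%:E)%E.
  move: (u01); rewrite in_itv/= lte_fin => /andP[u0 _].
  exact: lt_le_trans (ltrN10 _) u0.
have [_] := h u0.
rewrite (_ : (fun x => _) = cst 0); last by apply/funext => y; exact: F0.
by rewrite derive1_cst patchE mem_set.
Qed.

Lemma ae_eq_weak_derivative d (x v v' : R -> 'rV[R]_d) :
  L2_derivative x v -> L2_derivative x v' -> forall i,
  {ae mu, forall u, `[0 : R, 1]%classic u -> v u ord0 i = v' u ord0 i}.
Proof.
move=> xv xv' i.
have [mv iv ev] := xv i; have [mv' iv' ev'] := xv' i.
have jv := sqint_integrable (conj mv iv).
have jv' := sqint_integrable (conj mv' iv').
have jd : mu.-integrable `[0 : R, 1]
    (EFin \o (fun u => v u ord0 i - v' u ord0 i)).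
  exact: integrable_subr.
have d0 t : t \in `[0 : R, 1] ->
    \int[mu]_(u in `[0, t]) (v u ord0 i - v' u ord0 i) = 0.
  move=> t01.
  rewrite RintegralB//; last 2 first.
  - exact: integrable_itv0 jv.
  - exact: integrable_itv0 jv'.
  by rewrite -ev// -ev'// subrr.
have := ae_eq0_primitive jd d0.
apply: filterS; first exact: (ae_filter_ringOfSetsType mu).
by move=> u h u01; apply/eqP; rewrite -subr_eq0 h.
Qed.

Lemma sqint_L2_derivative d (x v : R -> 'rV[R]_d) :
  L2_derivative x v -> sqint_vec v.
Proof. by move=> xv i; have [] := xv i. Qed.

Lemma velocityP d (x : R -> 'rV[R]_d) : pathX x -> L2_derivative x (velocity x).
Proof. by case=> _ _ xv; rewrite /velocity; exact: xgetPex. Qed.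

(** The signature does not depend on the chosen weak derivative. *)
Lemma sig_revE d (x v : R -> 'rV[R]_d) : L2_derivative x v ->
  forall w s, s \in `[0 : R, 1] -> sig_rev x w s = vsig v w s.
Proof.
move=> xv w s s01.
have xv0 : L2_derivative x (velocity x).
  by rewrite /velocity; apply: xgetPex; exists v.
rewrite (_ : sig_rev x w s = vsig (velocity x) w s).
  apply: ae_eq_vsig => //; [exact: sqint_L2_derivative xv0|
    exact: sqint_L2_derivative xv|exact: ae_eq_weak_derivative].
by elim: w s {s01} => [//|i w ih] s /=; apply: eq_Rintegral => u _; rewrite ih.
Qed.

Lemma L2_derivative_scale d (x v : R -> 'rV[R]_d) (k : R) :
  L2_derivative x v -> L2_derivative (fun u => k *: x u) (fun u => k *: v u).
Proof.
move=> xv i; have [mv iv ev] := xv i; split.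
- rewrite (_ : (fun u => _) = (fun u => k * v u ord0 i)).
    exact: measurable_funM.
  by apply/funext => u; rewrite mxE.
- rewrite (_ : (fun u => _) = EFin \o (fun u => k ^+ 2 * v u ord0 i ^+ 2)).
    exact: integrable_scale.
  by apply/funext => u; rewrite /= mxE exprMn.
- move=> t t01; rewrite !mxE -mulrBr ev//.
  transitivity (\int[mu]_(u in `[0, t]) (k * v u ord0 i)); last first.
    by apply: eq_Rintegral => u _; rewrite mxE.
  rewrite RintegralZl//.
  exact: integrable_itv0 (sqint_integrable (conj mv iv)).
Qed.

End weak_derivative.

(** * Series indexed by words *)

Section words.
Context {d : nat}.

Fixpoint words (n : nat) : seq (seq 'I_d) :=
  if n is n'.+1 then [seq i :: w | i <- enum 'I_d, w <- words n'] else [:: [::]].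

Lemma mem_words n w : (w \in words n) = (size w == n).
Proof.
elim: n w => [|n ih] w /=; first by rewrite inE size_eq0.
apply/allpairsP/idP => [[[i u] /= [_ + ->]]|]; first by rewrite ih /= eqSS.
by case: w => [//|i w] /=; rewrite eqSS -ih => wn; exists (i, w); rewrite mem_enum.
Qed.

Lemma uniq_words n : uniq (words n).
Proof.
elim: n => [//|n ih] /=; apply: allpairs_uniq => //; first exact: enum_uniq.
by move=> [i u] [j w] _ _ /= [-> ->].
Qed.

Lemma size_words n : size (words n) = (d ^ n)%N.
Proof. by elim: n => [//|n ih] /=; rewrite size_allpairs ih size_enum_ord expnS. Qed.

Lemma esum_words (R : realType) (f : seq 'I_d -> \bar R) :
  (forall w, 0 <= f w)%E ->
  (\esum_(w in [set: seq 'I_d]) f w =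
   \sum_(n <oo) \sum_(w <- words n) f w)%E.
Proof.
move=> f0.
rewrite (_ : [set: seq 'I_d] = \bigcup_n [set` words n]); last first.
  by apply/seteqP; split => // w _; exists (size w) => //=; rewrite mem_words.
rewrite nneseries_sum_bigcup//.
  apply: eq_eseriesr => n _; rewrite esum_fset//; last exact: finite_seq.
  by rewrite -fsbig_seq// uniq_words.
apply/trivIsetP => i j _ _ ij; rewrite -subset0 => w [] /=.
by rewrite !mem_words => /eqP -> /eqP ij'; rewrite ij' eqxx in ij.
Qed.

End words.

Section word_series.
Context {R : realType} {d : nat}.
Implicit Types (f : seq 'I_d -> R) (C : R).

Definition word_sum f (N : nat) : R :=
  \sum_(0 <= n < N) \sum_(w <- words n) f w.

(** Since there are [d ^ n] words of length [n], a family of words bounded by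
    [C^n / n!] is dominated by the exponential series of [d C]. *)
Definition word_tail C (N : nat) : R :=
  expR (d%:R * C) - series (exp_coeff (d%:R * C)) N.

Lemma word_tail_cvg C : word_tail C @ \oo --> 0.
Proof.
rewrite -(subrr (expR (d%:R * C))); apply: cvgB; first exact: cvg_cst.
exact: is_cvg_series_exp_coeff.
Qed.

Lemma series_exp_coeff_le C N : 0 <= C -> series (exp_coeff C) N <= expR C.
Proof.
move=> C0; apply: nondecreasing_cvgn_le; last exact: is_cvg_series_exp_coeff.
by apply: nondecreasing_series => n _ _; exact: exp_coeff_ge0.
Qed.

Lemma word_level_le f C n : (forall w, `|f w| <= exp_coeff C (size w)) ->
  \sum_(w <- words n) `|f w| <= exp_coeff (d%:R * C) n.
Proof.
move=> fC; apply: (@le_trans _ _ (\sum_(w <- @words d n) exp_coeff C n)).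
  by rewrite big_seq [leRHS]big_seq; apply: ler_sum => w; rewrite mem_words =>
    /eqP <-.
rewrite big_const_seq count_predT size_words iter_addr_0.
by rewrite /exp_coeff /= exprMn -natrX mulr_natl -mulrnAl.
Qed.

Lemma word_sum_sub_le f C N M : (N <= M)%N ->
  (forall w, `|f w| <= exp_coeff C (size w)) ->
  0 <= C -> `|word_sum f M - word_sum f N| <= word_tail C N.
Proof.
move=> NM fC C0; rewrite /word_sum (big_cat_nat (n := N))//= addrAC subrr add0r.
apply: (@le_trans _ _ (\sum_(N <= n < M) exp_coeff (d%:R * C) n)).
  apply: le_trans (ler_norm_sum _ _ _) _; apply: ler_sum => n _.
  exact: le_trans (ler_norm_sum _ _ _) (word_level_le _ fC).
rewrite /word_tail lerBrDl -big_cat_nat//=.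
by apply: series_exp_coeff_le; rewrite mulr_ge0.
Qed.

Lemma ge0_word_sum_cvg f C : 0 <= C -> (forall w, 0 <= f w) ->
  (forall w, f w <= exp_coeff C (size w)) ->
  esum [set: seq 'I_d] (EFin \o f) \is a fin_num /\
  word_sum f @ \oo --> fine (esum [set: seq 'I_d] (EFin \o f)).
Proof.
move=> C0 f0 fC.
pose g n : \bar R := (\sum_(w <- words n) f w)%:E.
have g0 n : (0 <= g n)%E by rewrite lee_fin; exact: sumr_ge0.
have eg : esum [set: seq 'I_d] (EFin \o f) = (\sum_(n <oo) g n)%E.
  rewrite esum_words; last by move=> w; rewrite /= lee_fin.
  by apply: eq_eseriesr => n _; rewrite /g -sumEFin.
have sg : summable xpredT g.
  rewrite /summable; under eq_esum do rewrite gee0_abs//.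
  rewrite -nneseries_esum//.
  apply: (@le_lt_trans _ _ (expR (d%:R * C))%:E); last exact: ltry.
  apply: lime_le; first exact: is_cvg_nneseries.
  apply: nearW => N; rewrite /g sumEFin lee_fin.
  apply: le_trans (series_exp_coeff_le N _); last by rewrite mulr_ge0.
  apply: ler_sum => n _; apply: le_trans (word_level_le (f := f) (C := C) n _).
    by apply: ler_sum => w _; exact: ler_norm.
  by move=> w; rewrite ger0_norm.
rewrite eg (summable_nneseries_lim _ sg)//; split => //=.
exact: (summable_cvg _ sg).
Qed.

(** The unordered sum by which [ksig] is defined. *)
Definition word_series f : R :=
  fine (esum [set: seq 'I_d] (EFin \o f)^\+ -
        esum [set: seq 'I_d] (EFin \o f)^\-)%E.

Lemma summable_words f C : 0 <= C ->
  (forall w, `|f w| <= exp_coeff C (size w)) ->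
  summable [set: seq 'I_d] (EFin \o f).
Proof.
move=> C0 fC; rewrite summableE.
by have [] := @ge0_word_sum_cvg (fun w => `|f w|) C C0 (fun w => normr_ge0 _) fC.
Qed.

Lemma word_sum_cvg f C : 0 <= C ->
  (forall w, `|f w| <= exp_coeff C (size w)) ->
  word_sum f @ \oo --> word_series f.
Proof.
move=> C0 fC.
have p0 w : 0 <= Num.max (f w) 0 by rewrite le_max lexx orbT.
have m0 w : 0 <= Num.max (- f w) 0 by rewrite le_max lexx orbT.
have pC w : Num.max (f w) 0 <= exp_coeff C (size w).
  rewrite ge_max (le_trans _ (fC w)) ?ler_norm//.
  exact: le_trans (normr_ge0 _) (fC w).
have mC w : Num.max (- f w) 0 <= exp_coeff C (size w).
  rewrite ge_max (le_trans _ (fC w)); last by rewrite -normrN ler_norm.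
  exact: le_trans (normr_ge0 _) (fC w).
have [fp cp] := ge0_word_sum_cvg C0 p0 pC.
have [fm cm] := ge0_word_sum_cvg C0 m0 mC.
rewrite /word_series.
have -> : (EFin \o f)^\+%E = EFin \o (fun w => Num.max (f w) 0).
  by apply/funext => w; rewrite funeposE /= EFin_max.
have -> : (EFin \o f)^\-%E = EFin \o (fun w => Num.max (- f w) 0).
  by apply/funext => w; rewrite funenegE /= EFin_max.
rewrite fineB//.
rewrite (_ : word_sum f = word_sum (fun w => Num.max (f w) 0) \-
  word_sum (fun w => Num.max (- f w) 0)); first exact: cvgB.
apply/funext => N /=; rewrite /word_sum -sumrB; apply: eq_bigr => n _.
rewrite -sumrB; apply: eq_bigr => w _.
by case: (ltP (f w) 0); case: (ltP (- f w) 0); lra.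
Qed.

(** The tail bound depends on the family only through [C], which makes the
    convergence of the signature kernel uniform. *)
Lemma word_sum_tail f C N : 0 <= C ->
  (forall w, `|f w| <= exp_coeff C (size w)) ->
  `|word_series f - word_sum f N| <= word_tail C N.
Proof.
move=> C0 fC.
have h : `|word_sum f M - word_sum f N| @[M --> \oo] -->
    `|word_series f - word_sum f N|.
  apply: cvg_norm; apply: cvgB; last exact: cvg_cst.
  exact: word_sum_cvg C0 fC.
rewrite -(cvg_lim _ h)//; apply: limr_le; first by apply/cvg_ex; eexists; exact: h.
by exists N => // M /= NM; exact: word_sum_sub_le.
Qed.

End word_series.

(** * The signature kernel of two velocities *)

Section unit_square.
Context {R : realType}.
Notation mu := (@lebesgue_measure R).
Notation mu2 := (mu \x mu)%E.
Notation sq01 := (`[0 : R, 1]%classic `*` `[0 : R, 1]%classic).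

Lemma measurable_rect (s t : R) : measurable
  (`[0, s]%classic `*` `[0, t]%classic :
    set (measurableTypeR R * measurableTypeR R)).
Proof. exact: measurableX. Qed.

Lemma subset_rect (s t : R) : s \in `[0 : R, 1] -> t \in `[0 : R, 1] ->
  `[0, s]%classic `*` `[0, t]%classic `<=` sq01.
Proof.
by move=> s01 t01 [x y] [/= /(subset_itv0 s01) ? /(subset_itv0 t01) ?].
Qed.

Lemma integrable_rect (s t : R) (f : R * R -> \bar R) :
  s \in `[0 : R, 1] -> t \in `[0 : R, 1] ->
  mu2.-integrable sq01 f -> mu2.-integrable (`[0, s] `*` `[0, t]) f.
Proof.
move=> s01 t01; apply: (integrableS (measurable_rect 1 1) (measurable_rect s t)).
exact: subset_rect.
Qed.

Lemma Rintegral_iterated01 (f : R -> R -> R) s t :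
  mu2.-integrable sq01 (EFin \o (fun p => f p.1 p.2)) ->
  s \in `[0 : R, 1] -> t \in `[0 : R, 1] ->
  \int[mu]_(eta in `[0, s]) \int[mu]_(tau in `[0, t]) f eta tau =
  \int[mu2]_(p in `[0, s] `*` `[0, t]) f p.1 p.2.
Proof.
move=> fi s01 t01.
apply: (@Rintegral_fubini _ _ _ _ _ mu mu _ _ (fun p => f p.1 p.2)) => //.
exact: integrable_rect fi.
Qed.

End unit_square.

#[local] Hint Extern 0 (measurable (`[0, _]%classic `*` `[0, _]%classic)) =>
  exact: measurable_rect : core.

Section velocity_kernel.
Context {R : realType} {d : nat}.
Notation mu := (@lebesgue_measure R).
Notation mu2 := (mu \x mu)%E.
Notation sq01 := (`[0 : R, 1]%classic `*` `[0 : R, 1]%classic).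
Variables v v' : R -> 'rV[R]_d.
Hypotheses (sv : sqint_vec v) (sv' : sqint_vec v').

Definition vterm (s t : R) (w : seq 'I_d) : R := vsig v w s * vsig v' w t.
Definition vpart (N : nat) (s t : R) : R := word_sum (vterm s t) N.
Definition vker (s t : R) : R := word_series (vterm s t).

Let C := energy v + energy v'.

Let C0 : 0 <= C. Proof. by rewrite addr_ge0 ?energy_ge0. Qed.

Lemma vterm_le s t w : s \in `[0 : R, 1] -> t \in `[0 : R, 1] ->
  `|vterm s t w| <= exp_coeff C (size w).
Proof.
move=> s01 t01.
have h1 : vsig v w s ^+ 2 <= exp_coeff C (size w).
  apply: le_trans (vsig_bound w sv s01) _.
  by apply: exp_coeff_le; rewrite ?energy_ge0// lerDl energy_ge0.
have h2 : vsig v' w t ^+ 2 <= exp_coeff C (size w).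
  apply: le_trans (vsig_bound w sv' t01) _.
  by apply: exp_coeff_le; rewrite ?energy_ge0// lerDr energy_ge0.
rewrite /vterm normrM; move: h1 h2.
rewrite -(real_normK (num_real (vsig v w s))).
rewrite -(real_normK (num_real (vsig v' w t))).
by have := sqr_ge0 (`|vsig v w s| - `|vsig v' w t|); nra.
Qed.

Lemma vpart_cvg s t : s \in `[0 : R, 1] -> t \in `[0 : R, 1] ->
  vpart N s t @[N --> \oo] --> vker s t.
Proof. by move=> s01 t01; apply: word_sum_cvg C0 _ => w; exact: vterm_le. Qed.

Lemma vpart_tail N s t : s \in `[0 : R, 1] -> t \in `[0 : R, 1] ->
  `|vker s t - vpart N s t| <= @word_tail R d C N.
Proof. by move=> s01 t01; apply: word_sum_tail C0 _ => w; exact: vterm_le. Qed.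

Lemma vterm_summable s t : s \in `[0 : R, 1] -> t \in `[0 : R, 1] ->
  summable [set: seq 'I_d] (EFin \o vterm s t).
Proof. by move=> s01 t01; apply: summable_words C0 _ => w; exact: vterm_le. Qed.

Let integrable_sq01 (f g : R -> R) :
  mu.-integrable `[0 : R, 1] (EFin \o f) ->
  mu.-integrable `[0 : R, 1] (EFin \o g) ->
  mu2.-integrable sq01 (EFin \o (fun p => f p.1 * g p.2)).
Proof. by move=> fi gi; exact: integrable_tensor. Qed.

Let Rintegral_rect (s t : R) (f g : R -> R) :
  s \in `[0 : R, 1] -> t \in `[0 : R, 1] ->
  mu.-integrable `[0 : R, 1] (EFin \o f) ->
  mu.-integrable `[0 : R, 1] (EFin \o g) ->
  \int[mu2]_(p in `[0, s] `*` `[0, t]) (f p.1 * g p.2) =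
  \int[mu]_(u in `[0, s]) f u * \int[mu]_(u in `[0, t]) g u.
Proof.
move=> s01 t01 fi gi; apply: Rintegral_tensor => //.
  exact: integrable_itv0.
exact: integrable_itv0.
Qed.

Lemma integrable_dotv :
  mu2.-integrable sq01 (EFin \o (fun p => dotv (v p.1) (v' p.2))).
Proof.
apply: integrable_sumr; first exact: measurable_rect.
move=> i; apply: (integrable_sq01 (f := fun u => v u ord0 i)
  (g := fun u => v' u ord0 i)); exact/sqint_integrable.
Qed.

Lemma dotv_vpart N s t : dotv (v s) (v' t) * vpart N s t =
  \sum_(0 <= n < N) \sum_(w <- words n) \sum_i
    (vsig v w s * v s ord0 i) * (vsig v' w t * v' t ord0 i).
Proof.
rewrite /vpart /word_sum mulr_sumr; apply: eq_bigr => n _.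
rewrite mulr_sumr; apply: eq_bigr => w _.
rewrite /dotv mulr_suml; apply: eq_bigr => i _.
by rewrite /vterm; ring.
Qed.

Let integrable_step w i : mu2.-integrable sq01 (EFin \o (fun p =>
  (vsig v w p.1 * v p.1 ord0 i) * (vsig v' w p.2 * v' p.2 ord0 i))).
Proof.
by apply: (integrable_sq01 (f := fun u => vsig v w u * v u ord0 i)
  (g := fun u => vsig v' w u * v' u ord0 i)); exact: integrable_vsig.
Qed.

Lemma integrable_dotv_vpart N : mu2.-integrable sq01
  (EFin \o (fun p => dotv (v p.1) (v' p.2) * vpart N p.1 p.2)).
Proof.
rewrite (_ : (fun p => _) = (fun p => \sum_(0 <= n < N) \sum_(w <- words n)
  \sum_i (vsig v w p.1 * v p.1 ord0 i) * (vsig v' w p.2 * v' p.2 ord0 i))).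
  apply: integrable_sumr => // n; apply: integrable_sumr => // w.
  by apply: integrable_sumr => // i; exact: integrable_step.
by apply/funext => p; exact: dotv_vpart.
Qed.

(** Appending a letter [i] to a word integrates once more against the [i]-th
    components of both velocities; by Fubini the product of the two integrals
    is an integral over a rectangle, and summing over [i] produces the inner
    product of the velocities. *)
Lemma vpartS N s t : s \in `[0 : R, 1] -> t \in `[0 : R, 1] ->
  vpart N.+1 s t = 1 + \int[mu2]_(p in `[0, s] `*` `[0, t])
    (dotv (v p.1) (v' p.2) * vpart N p.1 p.2).
Proof.
move=> s01 t01; rewrite {1}/vpart /word_sum big_nat_recl//= big_seq1.
rewrite /vterm /= mulr1; congr (1 + _).
have iS w i : mu2.-integrable (`[0, s] `*` `[0, t]) (EFin \o (fun p =>
    (vsig v w p.1 * v p.1 ord0 i) * (vsig v' w p.2 * v' p.2 ord0 i))).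
  exact: integrable_rect (integrable_step w i).
have iw w : mu2.-integrable (`[0, s] `*` `[0, t]) (EFin \o (fun p => \sum_i
    (vsig v w p.1 * v p.1 ord0 i) * (vsig v' w p.2 * v' p.2 ord0 i))).
  by apply: integrable_sumr.
rewrite (_ : (fun p => _ * vpart N _ _) = (fun p => \sum_(0 <= n < N)
  \sum_(w <- words n)
  \sum_i (vsig v w p.1 * v p.1 ord0 i) * (vsig v' w p.2 * v' p.2 ord0 i)));
  last by apply/funext => p; exact: dotv_vpart.
rewrite Rintegral_sum//; last by move=> n; apply: integrable_sumr.
apply: eq_bigr => n _; rewrite Rintegral_sum//.
rewrite big_allpairs_dep/= big_enum exchange_big /=; apply: eq_bigr => w _.
rewrite Rintegral_sum//; apply: eq_bigr => i _ /=.
by rewrite -(Rintegral_rect s01 t01)//; exact: integrable_vsig.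
Qed.

(** Measurability is inherited from the truncations, which converge
    pointwise. *)
Lemma integrable_dotv_vker : mu2.-integrable sq01
  (EFin \o (fun p => dotv (v p.1) (v' p.2) * vker p.1 p.2)).
Proof.
apply: (@integrable_dominated _ _ _ mu2 _ _
  (fun p => expR (d%:R * C) * `|dotv (v p.1) (v' p.2)|)) => //.
- apply: (@measurable_fun_cvg _ _ _ _
    (fun N p => dotv (v p.1) (v' p.2) * vpart N p.1 p.2)) => //.
    by move=> N; have /measurable_EFinP := measurable_int _ (integrable_dotv_vpart N).
  move=> [s t] [/= s01 t01]; apply: cvgM; first exact: cvg_cst.
  exact: vpart_cvg.
- move=> [s t] [/= s01 t01]; rewrite normrM mulrC ler_wpM2r//.
  have := vpart_tail 0 s01 t01; rewrite /vpart /word_sum big_geq// subr0.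
  by rewrite /word_tail /series /= big_geq// subr0.
- by apply: integrable_scale => //; exact: integrable_norm integrable_dotv.
Qed.

Lemma vker_rect s t : s \in `[0 : R, 1] -> t \in `[0 : R, 1] ->
  vker s t = 1 + \int[mu2]_(p in `[0, s] `*` `[0, t])
    (dotv (v p.1) (v' p.2) * vker p.1 p.2).
Proof.
move=> s01 t01; have sub := subset_rect s01 t01.
have S f : mu2.-integrable sq01 f ->
  mu2.-integrable (`[0, s] `*` `[0, t]) f by exact: integrable_rect.
have cS : vpart N.+1 s t @[N --> \oo] --> vker s t.
  by rewrite (cvg_shiftS (fun N => vpart N s t)); exact: vpart_cvg.
rewrite -(cvg_lim _ cS)//; apply/cvg_lim => //.
under eq_fun do rewrite vpartS//.
apply: cvgD; first exact: cvg_cst.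
set J := \int[mu2]_(p in `[0, s] `*` `[0, t]) `|dotv (v p.1) (v' p.2)|.
have tJ : @word_tail R d C N * J @[N --> \oo] --> 0.
  by rewrite -[X in _ --> X](mul0r J); apply: cvgM;
    [exact: word_tail_cvg|exact: cvg_cst].
apply/cvgrPdist_le => e e0.
have /cvgrPdist_le /(_ e e0) := tJ.
apply: filterS => N; rewrite sub0r normrN => h.
apply: le_trans (le_trans (ler_norm _) h).
rewrite -RintegralB//; [|exact: S _ integrable_dotv_vker|
  exact: S _ (integrable_dotv_vpart N)].
apply: le_trans (le_normr_Rintegral _ _) _ => //.
  apply: integrable_subr => //; [exact: S _ integrable_dotv_vker|
    exact: S _ (integrable_dotv_vpart N)].
rewrite /J -RintegralZl//; last exact: integrable_norm (S _ integrable_dotv).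
apply: le_Rintegral => //.
- apply: integrable_norm; apply: integrable_subr => //.
    exact: S _ integrable_dotv_vker.
  exact: S _ (integrable_dotv_vpart N).
- by apply: integrable_scale => //; exact: integrable_norm (S _ integrable_dotv).
- move=> [x y] /sub [/= x01 y01].
  by rewrite -mulrBr normrM mulrC ler_wpM2r// vpart_tail.
Qed.

End velocity_kernel.

(** * Uniqueness for the homogeneous equation *)

Section sqint_closure.
Context {R : realType}.
Notation mu := (@lebesgue_measure R).

Lemma sqint_norm (f : R -> R) : sqint f -> sqint (fun u => `|f u|).
Proof.
move=> [mf f2]; split; first exact: measurableT_comp.
rewrite (_ : (fun u => _) = (fun u => f u ^+ 2))//.
by apply/funext => u; rewrite real_normK ?num_real.
Qed.

Lemma sqint_scale (k : R) (f : R -> R) : sqint f -> sqint (fun u => k * f u).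
Proof.
move=> [mf f2]; split; first exact: measurable_funM.
rewrite (_ : (fun u => _) = (fun u => k ^+ 2 * f u ^+ 2)).
  exact: integrable_scale.
by apply/funext => u; rewrite exprMn.
Qed.

Lemma sqint_add (f g : R -> R) : sqint f -> sqint g ->
  sqint (fun u => f u + g u).
Proof.
move=> [mf f2] [mg g2]; have mfg : measurable_fun `[0 : R, 1] (fun u => f u + g u).
  exact: measurable_funD.
split => //.
apply: (@integrable_dominated _ _ _ mu _ _
  (fun u => 2 * f u ^+ 2 + 2 * g u ^+ 2)) => //.
- exact: measurable_funX.
- move=> u _; rewrite ger0_norm ?sqr_ge0//.
  by have := sqr_ge0 (f u - g u); nra.
- by apply: integrable_addr => //; exact: integrable_scale.
Qed.

Lemma sqint_sum (I : Type) (r : seq I) (F : I -> R -> R) :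
  (forall i, sqint (F i)) -> sqint (fun u => \sum_(i <- r) F i u).
Proof.
move=> sF; elim: r => [|i r ih].
  rewrite (_ : (fun u => _) = cst 0); last by apply/funext => u; rewrite big_nil.
  split; first exact: measurable_cst.
  rewrite (_ : (fun u => _) = cst 0); first exact: integrable_cst01.
  by apply/funext => u; rewrite /= expr0n.
rewrite (_ : (fun u => _) = (fun u => F i u + \sum_(j <- r) F j u)).
  exact: sqint_add.
by apply/funext => u; rewrite big_cons.
Qed.

End sqint_closure.

Section uniqueness.
Context {R : realType} {d : nat}.
Notation mu := (@lebesgue_measure R).
Notation mu2 := (mu \x mu)%E.
Notation sq01 := (`[0 : R, 1]%classic `*` `[0 : R, 1]%classic).
Variables v v' : R -> 'rV[R]_d.
Hypotheses (sv : sqint_vec v) (sv' : sqint_vec v').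

(** An iterated Gronwall argument.  As [D] is controlled by a function [h] of
    the first variable, integrating out the second variable reduces the
    equation to [|D(s, t)| <= int_0^s h a] with [a] square integrable. *)
Lemma goursat_unique (c : R) (D : R -> R -> R) :
  mu2.-integrable sq01
    (EFin \o (fun p => dotv (v p.1) (v' p.2) * D p.1 p.2)) ->
  (forall s t, s \in `[0 : R, 1] -> t \in `[0 : R, 1] ->
    D s t = c * \int[mu2]_(p in `[0, s] `*` `[0, t])
                 (dotv (v p.1) (v' p.2) * D p.1 p.2)) ->
  forall s t, s \in `[0 : R, 1] -> t \in `[0 : R, 1] -> D s t = 0.
Proof.
move=> iD DE.
pose b i := \int[mu]_(u in `[0 : R, 1]) `|v' u ord0 i|.
have b0 i : 0 <= b i by exact: Rintegral_ge0.
pose a u := `|c| * \sum_i b i * `|v u ord0 i|.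
have sa : sqint a.
  apply: sqint_scale; apply: sqint_sum => i.
  by apply: sqint_scale; exact: sqint_norm (sv i).
pose A := \int[mu]_(u in `[0 : R, 1]) (a u ^+ 2).
have A0 : 0 <= A by apply: Rintegral_ge0 => u _; exact: sqr_ge0.
pose J := \int[mu2]_(p in sq01) `|dotv (v p.1) (v' p.2) * D p.1 p.2|.
have J0 : 0 <= J by exact: Rintegral_ge0.
pose M := (`|c| * J) ^+ 2.
have M0 : 0 <= M by exact: sqr_ge0.
have Dle s t : s \in `[0 : R, 1] -> t \in `[0 : R, 1] ->
    `|D s t| <= `|c| * \int[mu2]_(p in `[0, s] `*` `[0, t])
                         `|dotv (v p.1) (v' p.2) * D p.1 p.2|.
  move=> s01 t01; rewrite [in leLHS]DE// normrM ler_wpM2l//.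
  apply: le_normr_Rintegral => //.
  exact: integrable_rect iD.
have claim n s t : s \in `[0 : R, 1] -> t \in `[0 : R, 1] ->
    D s t ^+ 2 <= M * exp_coeff (A * s) n.
  elim: n s t => [|n ih] s t s01 t01.
    rewrite /exp_coeff /= expr0 fact0 divr1 mulr1.
    rewrite -(real_normK (num_real (D s t))) /M.
    apply: lerXn2r; rewrite ?nnegrE ?mulr_ge0//.
    apply: le_trans (Dle s t s01 t01) _; rewrite ler_wpM2l//.
    apply: ge0_Rintegral_subset => //; first exact: subset_rect.
    exact: integrable_norm iD.
  pose h u := Num.sqrt (M * exp_coeff (A * u) n).
  have hE u : u \in `[0 : R, 1] -> h u ^+ 2 = M * exp_coeff (A * u) n.
    rewrite in_itv/= => /andP[u0 _]; rewrite sqr_sqrtr// mulr_ge0//.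
    by rewrite exp_coeff_ge0 ?mulr_ge0.
  have mh : measurable_fun `[0 : R, 1] h.
    apply: measurable_funTS; apply: continuous_measurable_fun => u.
    apply: (@continuous_comp _ _ _ (fun u => M * exp_coeff (A * u) n) Num.sqrt);
      last exact: sqrt_continuous.
    apply: cvgM; [exact: cvg_cst|]; exact: continuous_exp_coeff.
  have hD u z : u \in `[0 : R, 1] -> z \in `[0 : R, 1] -> `|D u z| <= h u.
    move=> u01 z01; rewrite -sqrtr_sqr ler_wsqrtr//; exact: ih.
  have [B hB] : exists B, forall u, u \in `[0 : R, 1] -> `|h u| <= B.
    exists (1 + M * exp_coeff A n) => u u01; have := hE u u01.
    have e : exp_coeff (A * u) n <= exp_coeff A n.
      move: u01; rewrite in_itv/= => /andP[u0 u1].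
      by apply: exp_coeff_le; rewrite ?mulr_ge0// ler_piMr.
    rewrite -(real_normK (num_real (h u))).
    have := ler_wpM2l M0 e; have := normr_ge0 (h u); nra.
  have iv i : mu.-integrable `[0 : R, 1] (EFin \o (fun u => h u * `|v u ord0 i|)).
    apply: integrable_bounded01 mh hB _.
    exact/sqint_integrable/sqint_norm.
  have iv' i : mu.-integrable `[0 : R, 1] (EFin \o (fun u => `|v' u ord0 i|)).
    exact/sqint_integrable/sqint_norm.
  have it i : mu2.-integrable (`[0, s] `*` `[0, t]) (EFin \o (fun p =>
      (h p.1 * `|v p.1 ord0 i|) * `|v' p.2 ord0 i|)).
    apply: (@integrable_tensor _ _ _ _ _ mu mu _ _
      (fun u => h u * `|v u ord0 i|) (fun u => `|v' u ord0 i|)) => //;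
    exact: integrable_itv0.
  have key : `|D s t| <= \int[mu]_(u in `[0, s]) (h u * a u).
    apply: le_trans (Dle s t s01 t01) _.
    apply: (@le_trans _ _ (`|c| * \int[mu2]_(p in `[0, s] `*` `[0, t])
      \sum_i (h p.1 * `|v p.1 ord0 i|) * `|v' p.2 ord0 i|)).
      rewrite ler_wpM2l//; apply: le_Rintegral => //.
      - apply: integrable_norm.
        exact: integrable_rect iD.
      - exact: integrable_sumr.
      - move=> [u z] /(subset_rect s01 t01) [/= u01 z01].
        rewrite /dotv normrM.
        apply: (@le_trans _ _
          ((\sum_i `|v u ord0 i * v' z ord0 i|) * `|D u z|)).
          by rewrite ler_wpM2r// ler_norm_sum.
        rewrite mulr_suml; apply: ler_sum => i _.
        rewrite normrM mulrC mulrA ler_wpM2r// ler_wpM2r//.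
        exact: hD.
    rewrite Rintegral_sum//.
    rewrite (_ : \int[mu]_(u in `[0, s]) (h u * a u) = `|c| *
      \sum_i (b i * \int[mu]_(u in `[0, s]) (h u * `|v u ord0 i|))).
      rewrite ler_wpM2l//; apply: ler_sum => i _.
      rewrite (@Rintegral_tensor _ _ _ _ _ mu mu _ _
        (fun u => h u * `|v u ord0 i|) (fun u => `|v' u ord0 i|))//;
        try exact: integrable_itv0.
      rewrite mulrC ler_wpM2r//.
        by apply: Rintegral_ge0 => u _; rewrite mulr_ge0// sqrtr_ge0.
      by apply: ge0_Rintegral_subset => //; exact: subset_itv0.
    transitivity (\int[mu]_(u in `[0, s])
      (`|c| * \sum_i (b i * (h u * `|v u ord0 i|)))).
      apply: eq_Rintegral => u _; rewrite /a mulrCA; congr (_ * _).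
      by rewrite mulr_sumr; apply: eq_bigr => i _; ring.
    have ib i : mu.-integrable `[0, s]
        (EFin \o (fun u => b i * (h u * `|v u ord0 i|))).
      by apply: integrable_scale => //; exact: integrable_itv0.
    rewrite RintegralZl//; last exact: integrable_sumr.
    congr (_ * _); rewrite Rintegral_sum//; apply: eq_bigr => i _.
    by rewrite RintegralZl//; exact: integrable_itv0.
  apply: le_trans (cauchy_schwarz_exp_coeff M0 mh sa (lexx _) _ s01); last first.
    by move=> u u01; rewrite hE.
  rewrite -(real_normK (num_real (D s t))); apply: lerXn2r => //.
  by rewrite nnegrE (le_trans _ key).
move=> s t s01 t01; apply/eqP; rewrite -sqrf_eq0 eq_le sqr_ge0 andbT.
have cM : M * exp_coeff (A * s) n @[n --> \oo] --> 0.
  rewrite -(mulr0 M); apply: cvgM; first exact: cvg_cst.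
  exact: cvg_exp_coeff.
rewrite -(cvg_lim _ cM)//; apply: limr_ge; first by apply/cvg_ex; exists 0.
by apply: nearW => n; exact: claim.
Qed.

End uniqueness.

(** * Signature kernel and limiting kernel of paths *)

Section signature_kernel.
Context {R : realType} {d : nat}.
Notation mu := (@lebesgue_measure R).
Notation mu2 := (mu \x mu)%E.
Notation sq01 := (`[0 : R, 1]%classic `*` `[0 : R, 1]%classic).
Implicit Types x y v : R -> 'rV[R]_d.

(** [sig] reads words backwards, which only permutes the terms of the series
    defining the signature kernel. *)
Lemma sig_term_rev x y v v' s t : L2_derivative x v -> L2_derivative y v' ->
  s \in `[0 : R, 1] -> t \in `[0 : R, 1] ->
  sig_term x y s t = (EFin \o vterm v v' s t) \o rev.
Proof.
move=> xv yv s01 t01; apply/funext => w.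
by rewrite /sig_term /sig /= /vterm (sig_revE xv)// (sig_revE yv).
Qed.

Let esum_rev (f : seq 'I_d -> \bar R) :
  esum [set: seq 'I_d] (f \o rev) = esum [set: seq 'I_d] f.
Proof.
rewrite [RHS](reindex_esum [set: seq 'I_d] _ rev)//.
split => //; first by move=> a b _ _; exact: (can_inj revK).
by move=> w _; exists (rev w) => //; rewrite revK.
Qed.

Lemma ksigE x y v v' s t : L2_derivative x v -> L2_derivative y v' ->
  s \in `[0 : R, 1] -> t \in `[0 : R, 1] -> ksig x y s t = vker v v' s t.
Proof.
move=> xv yv s01 t01; rewrite /ksig (sig_term_rev xv yv)//.
rewrite /vker /word_series; congr (fine (_ - _)%E).
  rewrite -[RHS]esum_rev; congr esum.
  by apply/funext => w; rewrite /= !funeposE.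
rewrite -[RHS]esum_rev; congr esum.
by apply/funext => w; rewrite /= !funenegE.
Qed.

Lemma summable_sig_term x y v v' s t :
  L2_derivative x v -> L2_derivative y v' ->
  s \in `[0 : R, 1] -> t \in `[0 : R, 1] ->
  summable [set: seq 'I_d] (sig_term x y s t).
Proof.
move=> xv yv s01 t01; rewrite /summable (sig_term_rev xv yv)//.
rewrite (esum_rev (abse \o EFin \o vterm v v' s t)); apply: vterm_summable => //.
  exact: sqint_L2_derivative xv.
exact: sqint_L2_derivative yv.
Qed.

Lemma ksig_signature_pde x y : pathX x -> pathX y ->
  signature_pde x y (ksig x y).
Proof.
move=> /velocityP xv /velocityP yv.
have sv := sqint_L2_derivative xv; have sv' := sqint_L2_derivative yv.
set v := velocity x in xv sv *; set v' := velocity y in yv sv' *.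
have z01 : (0 : R) \in `[0 : R, 1] by rewrite in_itv/= lexx ler01.
have i1 : mu2.-integrable sq01
    (EFin \o (fun p => dotv (v p.1) (v' p.2) * ksig x y p.1 p.2)).
  apply: eq_integrable (integrable_dotv_vker sv sv') => //.
  by move=> [s t]; rewrite inE => -[/= s01 t01]; rewrite (ksigE xv yv).
have E s t : s \in `[0 : R, 1] -> t \in `[0 : R, 1] ->
    ksig x y s t = 1 + \int[mu]_(eta in `[0, s]) \int[mu]_(tau in `[0, t])
      (dotv (v eta) (v' tau) * ksig x y eta tau).
  move=> s01 t01.
  rewrite (Rintegral_iterated01
    (f := fun eta tau => dotv (v eta) (v' tau) * ksig x y eta tau))//.
  rewrite (ksigE xv yv)// vker_rect//; congr (1 + _).
  apply: eq_Rintegral => -[a b]; rewrite inE => /(subset_rect s01 t01).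
  by move=> -[/= a01 b01]; rewrite (ksigE xv yv).
split => //.
- move=> s s01; rewrite E// [X in 1 + X](_ : _ = 0) ?addr0//.
  rewrite set_itv1; under eq_Rintegral do rewrite Rintegral_set1.
  by rewrite Rintegral_cst// mul0r.
- by move=> t t01; rewrite E// set_itv1 Rintegral_set1 addr0.
Qed.

End signature_kernel.

Section affine_kernel.
Context {R : realType} {d : nat}.
Notation mu := (@lebesgue_measure R).
Notation mu2 := (mu \x mu)%E.
Notation sq01 := (`[0 : R, 1]%classic `*` `[0 : R, 1]%classic).
Variables (sa sA sb : R).
Hypothesis sA0 : sA != 0.
Implicit Types (v : R -> 'rV[R]_d) (K : R -> R -> R).

Definition affine_ker v v' (s t : R) : R :=
  (sa ^+ 2 + sb ^+ 2 / sA ^+ 2) *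
    vker (fun u => sA *: v u) (fun u => sA *: v' u) s t - sb ^+ 2 / sA ^+ 2.

(** The integrand of the kernel equation once the Gaussian expectation has
    been replaced by [K]. *)
Definition affine_integrand v v' K (p : R * R) : R :=
  (sA ^+ 2 * K p.1 p.2 + sb ^+ 2) * dotv (v p.1) (v' p.2).

Lemma sqint_vecZ v : sqint_vec v -> sqint_vec (fun u => sA *: v u).
Proof.
move=> sv i; rewrite (_ : (fun u => _) = (fun u => sA * v u ord0 i)).
  exact: sqint_scale (sv i).
by apply/funext => u; rewrite mxE.
Qed.

Let dotvZ (a b : 'rV[R]_d) : dotv (sA *: a) (sA *: b) = sA ^+ 2 * dotv a b.
Proof. by rewrite /dotv mulr_sumr; apply: eq_bigr => i _; rewrite !mxE; ring. Qed.

(** Adding [sb^2 / sA^2] absorbs the constant term, and the factor [sA^2] is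
    absorbed by scaling both velocities. *)
Let affine_integrandE v v' : affine_integrand v v' (affine_ker v v') =
  fun p => (sa ^+ 2 + sb ^+ 2 / sA ^+ 2) *
    (dotv (sA *: v p.1) (sA *: v' p.2) *
     vker (fun u => sA *: v u) (fun u => sA *: v' u) p.1 p.2).
Proof.
apply/funext => p; rewrite dotvZ /affine_integrand /affine_ker.
by field.
Qed.

Lemma integrable_affine_ker v v' : sqint_vec v -> sqint_vec v' ->
  mu2.-integrable sq01 (EFin \o affine_integrand v v' (affine_ker v v')).
Proof.
move=> sv sv'; rewrite affine_integrandE; apply: integrable_scale => //.
exact: integrable_dotv_vker (sqint_vecZ sv) (sqint_vecZ sv').
Qed.

Lemma affine_ker_rect v v' s t : sqint_vec v -> sqint_vec v' ->
  s \in `[0 : R, 1] -> t \in `[0 : R, 1] ->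
  affine_ker v v' s t = sa ^+ 2 +
    \int[mu2]_(p in `[0, s] `*` `[0, t])
      affine_integrand v v' (affine_ker v v') p.
Proof.
move=> sv sv' s01 t01; rewrite affine_integrandE RintegralZl//; last first.
  apply: integrable_rect => //.
  exact: integrable_dotv_vker (sqint_vecZ sv) (sqint_vecZ sv').
rewrite /affine_ker (vker_rect (sqint_vecZ sv) (sqint_vecZ sv') s01 t01).
by ring.
Qed.

Lemma affine_ker_unique v v' K : sqint_vec v -> sqint_vec v' ->
  mu2.-integrable sq01 (EFin \o affine_integrand v v' K) ->
  (forall s t, s \in `[0 : R, 1] -> t \in `[0 : R, 1] ->
    K s t = sa ^+ 2 + \int[mu2]_(p in `[0, s] `*` `[0, t])
                        affine_integrand v v' K p) ->
  forall s t, s \in `[0 : R, 1] -> t \in `[0 : R, 1] ->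
  K s t = affine_ker v v' s t.
Proof.
move=> sv sv' iK EK s t s01 t01.
have iG := integrable_affine_ker sv sv'.
apply/eqP; rewrite -subr_eq0; apply/eqP; move: s t s01 t01.
have DE p : dotv (v p.1) (v' p.2) * (K p.1 p.2 - affine_ker v v' p.1 p.2) =
    (sA ^+ 2)^-1 * (affine_integrand v v' K p -
                  affine_integrand v v' (affine_ker v v') p).
  by rewrite /affine_integrand; field.
apply: (goursat_unique sv sv' (c := sA ^+ 2)
  (D := fun s t => K s t - affine_ker v v' s t)).
  rewrite (_ : (fun p => _) = (fun p => (sA ^+ 2)^-1 *
    (affine_integrand v v' K p - affine_integrand v v' (affine_ker v v') p))).
    by apply: integrable_scale => //; exact: integrable_subr.
  exact/funext.
move=> s t s01 t01.
have S f : mu2.-integrable sq01 f ->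
    mu2.-integrable (`[0, s] `*` `[0, t]) f.
  exact: integrable_rect.
rewrite (EK s t)// (affine_ker_rect sv sv')//.
under [in RHS]eq_Rintegral do rewrite DE.
rewrite RintegralZl//; last first.
  by apply: integrable_subr => //; exact: S.
rewrite mulVKf ?expf_neq0// RintegralB//; [|exact: S..].
by ring.
Qed.

Lemma psd_sym2 (p q r : R) :
  (forall a b, 0 <= a ^+ 2 * p + 2 * a * b * q + b ^+ 2 * r) ->
  psd (sym2 p q r).
Proof.
move=> h; split.
  apply/matrixP => i j; rewrite !mxE eq_sym.
  by case: (eqVneq i j) => [->|].
move=> u; rewrite !mxE !big_ord_recl !big_ord0 !mxE/= !big_ord_recl !big_ord0.
rewrite !mxE/=.
have := h (u ord0 ord0) (u ord0 (lift ord0 ord0)).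
by move/le_trans; apply; rewrite le_eqVlt; apply/orP; left; apply/eqP; ring.
Qed.

(** Positivity holds for every truncation containing the empty word, and
    passes to the limit. *)
Lemma psd_affine_ker v v' s t : sqint_vec v -> sqint_vec v' ->
  s \in `[0 : R, 1] -> t \in `[0 : R, 1] ->
  psd (sym2 (affine_ker v v s s) (affine_ker v v' s t) (affine_ker v' v' t t)).
Proof.
move=> sv sv' s01 t01; apply: psd_sym2 => a b.
have zv := sqint_vecZ sv; have zv' := sqint_vecZ sv'.
rewrite /affine_ker.
set w1 := fun u => sA *: v u; set w2 := fun u => sA *: v' u.
set k := sa ^+ 2 + sb ^+ 2 / sA ^+ 2; set l := sb ^+ 2 / sA ^+ 2.
have k0 : 0 <= k.
  by rewrite addr_ge0 ?sqr_ge0// divr_ge0 ?sqr_ge0.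
have c11 := vpart_cvg zv zv s01 s01.
have c12 := vpart_cvg zv zv' s01 t01.
have c22 := vpart_cvg zv' zv' t01 t01.
pose q x11 x12 x22 := a ^+ 2 * (k * x11 - l) + 2 * a * b * (k * x12 - l) +
  b ^+ 2 * (k * x22 - l).
have cq : q (vpart w1 w1 N s s) (vpart w1 w2 N s t) (vpart w2 w2 N t t)
    @[N --> \oo] --> q (vker w1 w1 s s) (vker w1 w2 s t) (vker w2 w2 t t).
  have aff (c : R) (z : nat -> R) (z0 : R) : z N @[N --> \oo] --> z0 ->
      c * (k * z N - l) @[N --> \oo] --> c * (k * z0 - l).
    move=> zz; apply: cvgM; first exact: cvg_cst.
    by apply: cvgB; [apply: cvgM; [exact: cvg_cst|]|exact: cvg_cst].
  by apply: cvgD; [apply: cvgD|]; exact: aff.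
rewrite -[leRHS]/(q _ _ _) -(cvg_lim _ cq)//.
apply: limr_ge; first by apply/cvg_ex; eexists; exact: cq.
exists 1 => // -[//|N] _.
rewrite /q /vpart /word_sum !big_nat_recl//= !big_seq1 /vterm /= !mulr1.
pose S := \sum_(0 <= n < N) \sum_(w <- @words d n.+1)
  (a * vsig w1 w s + b * vsig w2 w t) ^+ 2.
rewrite [leRHS](_ : _ = (a + b) ^+ 2 * sa ^+ 2 + k * S).
  apply: addr_ge0; first by rewrite mulr_ge0// sqr_ge0.
  apply: mulr_ge0 => //; apply: sumr_ge0 => n _.
  by apply: sumr_ge0 => w _; exact: sqr_ge0.
have -> : S = a ^+ 2 * (\sum_(0 <= n < N) \sum_(w <- @words d n.+1)
      vsig w1 w s * vsig w1 w s) +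
    2 * a * b * (\sum_(0 <= n < N) \sum_(w <- @words d n.+1)
      vsig w1 w s * vsig w2 w t) +
    b ^+ 2 * (\sum_(0 <= n < N) \sum_(w <- @words d n.+1)
      vsig w2 w t * vsig w2 w t).
  rewrite !mulr_sumr -!big_split/=; apply: eq_bigr => n _.
  rewrite !mulr_sumr -!big_split/=; apply: eq_bigr => w _.
  by ring.
by rewrite /k -/l; ring.
Qed.

Lemma kernel_integrand_id (x y : R -> 'rV[R]_d) Kxx K Kyy :
  (forall eta tau, eta \in `[0 : R, 1] -> tau \in `[0 : R, 1] ->
    psd (sym2 (Kxx eta eta) (K eta tau) (Kyy tau tau))) ->
  forall p, sq01 p -> kernel_integrand sA sb id x y Kxx K Kyy p.1 p.2 =
    affine_integrand (velocity x) (velocity y) K p.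
Proof.
move=> pK [s t] [/= s01 t01].
by rewrite /kernel_integrand Vphi_id//; exact: pK.
Qed.

Lemma kernel_equation_affine (x y : R -> 'rV[R]_d) : pathX x -> pathX y ->
  let vx := velocity x in let vy := velocity y in
  kernel_equation sa sA sb id x y
    (affine_ker vx vx) (affine_ker vx vy) (affine_ker vy vy).
Proof.
move=> /velocityP xv /velocityP yv vx vy.
have sv := sqint_L2_derivative xv; have sv' := sqint_L2_derivative yv.
have pK eta tau : eta \in `[0 : R, 1] -> tau \in `[0 : R, 1] ->
    psd (sym2 (affine_ker vx vx eta eta) (affine_ker vx vy eta tau)
              (affine_ker vy vy tau tau)).
  exact: psd_affine_ker.
have iK : mu2.-integrable sq01 (EFin \o (fun p => kernel_integrand sA sb id x y
    (affine_ker vx vx) (affine_ker vx vy) (affine_ker vy vy) p.1 p.2)).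
  apply: eq_integrable (integrable_affine_ker sv sv') => //.
  move=> p; rewrite inE => sp /=.
  by rewrite kernel_integrand_id.
split => // s t s01 t01.
rewrite (Rintegral_iterated01 iK)// affine_ker_rect//; congr (_ + _).
apply: eq_Rintegral => p; rewrite inE => /(subset_rect s01 t01) sp.
by rewrite kernel_integrand_id.
Qed.

Lemma kernel_equation_unique (x y : R -> 'rV[R]_d) Kxx K Kyy :
  pathX x -> pathX y -> kernel_equation sa sA sb id x y Kxx K Kyy ->
  forall s t, s \in `[0 : R, 1] -> t \in `[0 : R, 1] ->
  K s t = affine_ker (velocity x) (velocity y) s t.
Proof.
move=> /velocityP xv /velocityP yv [pK iK EK].
have kE := kernel_integrand_id x y pK.
apply: affine_ker_unique.
- exact: sqint_L2_derivative xv.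
- exact: sqint_L2_derivative yv.
- apply: eq_integrable iK => //.
  by move=> p; rewrite inE => sp /=; rewrite kE.
- move=> s t s01 t01; rewrite EK// (Rintegral_iterated01 iK)//.
  congr (_ + _); apply: eq_Rintegral => p.
  by rewrite inE => /(subset_rect s01 t01) sp; rewrite kE.
Qed.

End affine_kernel.

Theorem corollary4p2 (R : realType) (d : nat) (sa sA sb : R)
    (sa_gt0 : 0 < sa) (sA_gt0 : 0 < sA) (sb_ge0 : 0 <= sb) :
  (forall x y : R -> 'rV[R]_d, pathX x -> pathX y ->
    (exists K, is_limiting_kernel sa sA sb id x y K) /\
    (forall K, is_limiting_kernel sa sA sb id x y K ->
      forall s t : R, s \in `[0, 1] -> t \in `[0, 1] ->
        K s t = (sa ^+ 2 + sb ^+ 2 / sA ^+ 2) *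
                  ksig (fun u => sA *: x u) (fun u => sA *: y u) s t
                - sb ^+ 2 / sA ^+ 2))
  /\
  (forall x y : R -> 'rV[R]_d, pathX x -> pathX y ->
    (forall s t : R, s \in `[0, 1] -> t \in `[0, 1] ->
      summable [set: seq 'I_d] (sig_term x y s t)) /\
    signature_pde x y (ksig x y)).
Proof.
have sA0 : sA != 0 by rewrite gt_eqF.
split => x y Xx Xy; have xv := velocityP Xx; have yv := velocityP Xy.
- split.
    exists (affine_ker sa sA sb (velocity x) (velocity y)).
    exists (affine_ker sa sA sb (velocity x) (velocity x)).
    exists (affine_ker sa sA sb (velocity y) (velocity y)).
    by split; exact: kernel_equation_affine.
  move=> K [Kxx [Kyy [_ KE _]]] s t s01 t01.
  rewrite (kernel_equation_unique sA0 Xx Xy KE)//.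
  by rewrite (ksigE (L2_derivative_scale sA xv) (L2_derivative_scale sA yv)).
- split; last exact: ksig_signature_pde.
  by move=> s t s01 t01; exact: summable_sig_term xv yv s01 t01.
Qed.
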